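(* Let $d\ge1$, $0\le r\le a<1$, let $\omega$ be a finite nonnegative measure on $\mathbb{R}^d$ and let $\phi\in\mathcal{P}(\mathbb{R}^d)$. Assume that $\psi_r*\phi\in\mathfrak{P}_r$ and that $\psi_a*\omega$ is admissible for the action of $\mathcal{L}_r$ (see context). Set $$F:=\psi_a*\omega-\psi_r*\phi .$$ Assume that $F$ has a Borel gradient representative that is $\phi$-integrable. Let $$\Omega:=\operatorname{int}\{x:\ \phi=0\text{ in a neighbourhood of }x\},\qquad S:=\mathbb{R}^d\setminus\Omega.$$ Then $\phi$ is a zero-flux stationary state if and only if $$\nabla F=0\quad\phi\text{-a.e. on }S$$ and $$\phi=Q_{a,r}-\mathcal{L}_rF,\qquad Q_{a,r}:=\mathcal{L}_r(\psi_a*\omega).$$ Equivalently, the pair $(\Omega,F)$, with $\phi:=Q_{a,r}-\mathcal{L}_rF$, satisfies $$\mathcal{L}_rF=Q_{a,r}\ \text{ in }\Omega,\qquad \nabla F=0\ \ \phi\text{-a.e. on }S,$$ $$Q_{a,r}-\mathcal{L}_rF\ge0\ \text{ as a measure supported in }S,\qquad \int_{\mathbb{R}^d}(Q_{a,r}-\mathcal{L}_rF)=1 .$$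
   Context: For $s\in[0,1)$: $\psi_s(x)=|x|^{1+s}$, $K_s(x)=\nabla\psi_s(x)=(1+s)|x|^{s-1}x$ for $x\ne0$, $K_s(0)=0$. $\mathcal{P}(\mathbb{R}^d)$ is the set of probability measures. Fourier transform: $\widehat f(\xi)=\int e^{-ix\cdot\xi}f(x)\,dx$, extended to tempered distributions $\mathcal{S}'(\mathbb{R}^d)$. One has $\widehat{\psi_s}=\gamma_{d,s}\operatorname{fp}|\xi|^{-d-1-s}$ with a constant $\gamma_{d,s}\neq0$, where for $\varphi\in\mathcal{S}(\mathbb{R}^d)$ $$\langle\operatorname{fp}|\xi|^{-d-1-s},\varphi\rangle=\lim_{\varepsilon\downarrow0}\Bigl[\int_{|\xi|>\varepsilon}|\xi|^{-d-1-s}\varphi(\xi)\,d\xi-\tfrac{|\mathbb{S}^{d-1}|}{1+s}\varepsilon^{-1-s}\varphi(0)\Bigr].$$ $\mathfrak{P}_s$ is the set of $f\in\mathcal{S}'(\mathbb{R}^d)$ for which there is a finite measure $\mu$ with $f=\psi_s*\mu$ in $\mathcal{S}'(\mathbb{R}^d)$; $\mu$ is then unique and one defines $\mathcal{L}_sf:=\mu$ (on this class $\mathcal{L}_s$ corresponds to the Fourier multiplier $\gamma_{d,s}^{-1}|\xi|^{d+1+s}$, i.e. $\mathcal{L}_s=c_{d,s}(-\Delta)^{(d+1+s)/2}$ with $c_{d,s}\ne0$). For $0\le r\le a<1$ and a finite measure $\mu$ such that $\psi_a*\mu$ is a tempered distribution (''$\psi_a*\mu$ is admissible for the action of $\mathcal{L}_r$''),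 $\mathcal{L}_r(\psi_a*\mu)\in\mathcal{S}'(\mathbb{R}^d)$ is defined by $\widehat{\mathcal{L}_r(\psi_a*\mu)}(\xi)=\frac{\gamma_{d,a}}{\gamma_{d,r}}|\xi|^{r-a}\widehat\mu(\xi)$. For $F=\psi_a*\omega-\psi_r*\phi$ as in the claim, $\mathcal{L}_rF:=\mathcal{L}_r(\psi_a*\omega)-\mathcal{L}_r(\psi_r*\phi)$. Zero-flux stationary state: a probability measure $\phi$ with $\phi\,\nabla F=0$ in the sense of vector-valued distributions, equivalently $\int\xi(x)\cdot(K_a*\omega(x)-K_r*\phi(x))\,d\phi(x)=0$ for every $\xi\in C_c^\infty(\mathbb{R}^d;\mathbb{R}^d)$ for which the integral is well defined. *)

(* Defs.v *)
From HB Require Import structures.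
From mathcomp Require Import all_boot all_order all_algebra.
From mathcomp Require Import all_classical all_reals all_analysis.
From mathcomp Require Import measurable_realfun.
From mathcomp Require Import complex.

Set Implicit Arguments.
Unset Strict Implicit.
Unset Printing Implicit Defensive.

Import Order.TTheory GRing.Theory Num.Theory.
Import numFieldNormedType.Exports.

Local Open Scope classical_set_scope.
Local Open Scope ring_scope.

Section borel_rV.
Variables (R : realType) (d : nat).

HB.instance Definition _ := @isMeasurable.Build
  (sigma_display (@open 'rV[R]_d)) 'rV[R]_d
  <<s @open 'rV[R]_d >> (@sigma_algebra0 _ setT _)
  (@sigma_algebraC 'rV[R]_d _) (@sigma_algebra_bigcup _ setT _).

End borel_rV.

Section cons_rV.
Variable R : realType.

Lemma open_measurable_rV d (U : set 'rV[R]_d) : open U -> measurable U.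
Proof. exact: sub_sigma_algebra. Qed.

Lemma continuous_measurable_rV_R d (f : 'rV[R]_d -> R) :
  continuous f -> measurable_fun setT f.
Proof.
move=> cf.
apply: (measurability _ (measurable_realfun.RGenOpens.measurableE R)) => //.
move=> _ [_ [a [b ->]] <-]; rewrite setTI; apply: open_measurable_rV.
by move/continuousP : cf; apply; exact: interval_open.
Qed.

Lemma continuous_measurable_rV_rV d e (f : 'rV[R]_d -> 'rV[R]_e) :
  continuous f -> measurable_fun setT f.
Proof.
move=> cf; apply: (@measurability _ _ _ _ _ _ (@open 'rV[R]_e)) => //.
move=> _ [U oU <-]; rewrite setTI; apply: open_measurable_rV.
by move/continuousP : cf; apply.
Qed.

Definition cons_rV n (x : R * 'rV[R]_n) : 'rV[R]_n.+1 :=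
  row_mx (x.1%:M : 'rV[R]_1) x.2.

Definition uncons_rV n (v : 'rV[R]_n.+1) : R * 'rV[R]_n :=
  (v ord0 ord0, rsubmx (v : 'rV[R]_(1 + n))).

Lemma cons_rV0 n (x : R * 'rV[R]_n) : cons_rV x ord0 ord0 = x.1.
Proof.
transitivity (row_mx (x.1%:M : 'rV[R]_1) x.2 ord0 (lshift n ord0)).
  by congr (row_mx _ _ _ _); exact: val_inj.
by rewrite row_mxEl mxE eqxx mulr1n.
Qed.

Lemma cons_rVS n (x : R * 'rV[R]_n) (i : 'I_n) :
  cons_rV x ord0 (lift ord0 i) = x.2 ord0 i.
Proof.
transitivity (row_mx (x.1%:M : 'rV[R]_1) x.2 ord0 (rshift 1 i)).
  by congr (row_mx _ _ _ _); exact: val_inj.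
by rewrite row_mxEr.
Qed.

Lemma cons_rVK n : cancel (@cons_rV n) (@uncons_rV n).
Proof.
by case=> x v; rewrite /uncons_rV cons_rV0 /cons_rV /= row_mxKr.
Qed.

Lemma measurable_uncons_rV n : measurable_fun setT (@uncons_rV n).
Proof.
apply/measurable_fun_pairP; split.
  by apply: continuous_measurable_rV_R => v; exact: coord_continuous.
by apply: continuous_measurable_rV_rV => v; exact: (@continuous_rsubmx R 1 1 n).
Qed.

Lemma measurable_cons_rV n : measurable_fun setT (@cons_rV n).
Proof.
apply: (@measurability _ _ _ _ _ _ (@open 'rV[R]_n.+1)) => //.
move=> _ [U oU <-]; rewrite setTI.
pose q (p : 'rV[rat]_n.+1 * nat) : 'rV[R]_n.+1 := map_mx ratr p.1.
pose B (p : 'rV[rat]_n.+1 * nat) := ball (q p) (p.2.+1%:R^-1 : R).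
have -> : U = \bigcup_(p in [set p | B p `<=` U]) B p.
  apply/seteqP; split=> [v Uv|v [p /= BU Bv]]; last exact: BU.
  have /nbhs_ballP[e /= e0 veU] : nbhs v U by exact: open_nbhs_nbhs.
  have [k] : exists k : nat, k.+1%:R^-1 < e / 2.
    have e20 : 0 < e / 2 by rewrite divr_gt0.
    exists (Num.truncn (e / 2)^-1).
    rewrite invf_plt ?posrE ?ltr0n//.
    exact: truncnS_gt.
  move=> ke.
  have k0 : 0 < k.+1%:R^-1 :> R by rewrite invr_gt0 ltr0n.
  have /choice[w hw] : forall i : 'I_n.+1, exists x : rat,
      `|v ord0 i - ratr x| < k.+1%:R^-1.
    move=> i; have : v ord0 i - k.+1%:R^-1 < v ord0 i + k.+1%:R^-1.
      by rewrite ltrBlDr -addrA ltrDl addr_gt0.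
    move=> /rat_in_itvoo[x]; rewrite in_itv/= => /andP[x1 x2].
    by exists x; rewrite ltr_distlC x1 x2.
  have Bv : B (\row_i w i, k) v.
    split=> // i j; rewrite /ball/= /q !mxE distrC.
    by rewrite (ord1 i).
  exists (\row_i w i, k) => //= z [_ Bz]; apply: veU; split=> // i j.
  case: Bv => _ /(_ i j)/ball_sym vq.
  have := ball_triangle vq (Bz i j).
  apply: le_ball; rewrite (splitr e) lerD// ltW//.
rewrite preimage_bigcup; rewrite bigcup_mkcond; apply: countable_bigcupT_measurable => [|p].
  exact: countableP.
case: ifPn => // _.
have -> : (@cons_rV n) @^-1` (B p) =
    ball (q p ord0 ord0) p.2.+1%:R^-1 `*`
    ball (rsubmx (q p : 'rV[R]_(1 + n))) (p.2.+1%:R^-1 : R).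
  apply/seteqP; split=> -[x v] /=.
    move=> [k0 h]; split.
      by have := h ord0 ord0; rewrite cons_rV0.
    split=> // i j; rewrite (ord1 i).
    have := h ord0 (lift ord0 j); rewrite cons_rVS/=.
    rewrite [in X in _ -> X]mxE; congr (ball (q p _ _) _ _); exact: val_inj.
  move=> [h0 [k0 hS]]; split=> // i j; rewrite (ord1 i).
  case: (unliftP ord0 j) => [j' ->|->]; last by rewrite cons_rV0.
  rewrite cons_rVS; have := hS ord0 j'; rewrite [in X in X -> _]mxE/=.
  by congr (ball (q p _ _) _ _); exact: val_inj.
apply: measurableX; first exact: measurable_realfun.measurable_ball.
apply: open_measurable_rV; exact: ball_open.
Qed.

End cons_rV.

Section cons_measure.
Local Open Scope ereal_scope.
Variables (R : realType) (n : nat).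
Variable mu : {sigma_finite_measure set 'rV[R]_n -> \bar R}.

(* Image of the product of Lebesgue measure on R and [mu] under the
   identification of R * R^n with R^(n+1). *)
Definition cons_measure : set 'rV[R]_n.+1 -> \bar R :=
  pushforward ((@lebesgue_measure R) \x mu) (@cons_rV R n).

Let cons_measure0 : cons_measure set0 = 0.
Proof. by rewrite /cons_measure /pushforward preimage_set0 measure0. Qed.

Let cons_measure_ge0 A : 0 <= cons_measure A.
Proof. exact: (measure_ge0 ((@lebesgue_measure R) \x mu)). Qed.

Let cons_measure_sigma_additive : semi_sigma_additive cons_measure.
Proof.
move=> F mF tF mUF; rewrite /cons_measure /pushforward preimage_bigcup.
have mcons A : measurable A -> measurable (@cons_rV R n @^-1` A).
  by move=> mA; rewrite -[X in measurable X]setTI; exact: measurable_cons_rV.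
apply: measure_semi_sigma_additive.
- by move=> k; exact: mcons.
- apply/trivIsetP => /= i j _ _ ij; rewrite -preimage_setI.
  by move/trivIsetP : tF => /(_ _ _ _ _ ij) ->//; rewrite preimage_set0.
- by rewrite -preimage_bigcup; exact: mcons.
Qed.

HB.instance Definition _ := isMeasure.Build _ _ _ cons_measure
  cons_measure0 cons_measure_ge0 cons_measure_sigma_additive.

Let cons_measure_sigma_finite : sigma_finite setT cons_measure.
Proof.
have /sigma_finiteP[F [TF ndF Foo]] := sigma_finiteT (@lebesgue_measure R).
have /sigma_finiteP[G [TG ndG Goo]] := sigma_finiteT mu.
exists (fun k => @uncons_rV R n @^-1` (F k `*` G k)).
  rewrite -preimage_bigcup -[LHS](preimage_setT (@uncons_rV R n)).
  congr (_ @^-1` _); apply/seteqP; split=> // -[x v] _.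
  have [k _ Fx] : (\bigcup_k F k) x by rewrite -TF.
  have [l _ Gv] : (\bigcup_k G k) v by rewrite -TG.
  exists (maxn k l) => //; split=> /=.
    by move: x Fx; exact/subsetPset/ndF/leq_maxl.
  by move: v Gv; exact/subsetPset/ndG/leq_maxr.
move=> k; have [mF Fk] := Foo k; have [mG Gk] := Goo k; split.
  rewrite -[X in measurable X]setTI; apply: measurable_uncons_rV => //.
  exact: measurableX.
rewrite /cons_measure /pushforward -comp_preimage.
rewrite (_ : _ \o _ = id) ?preimage_id; last first.
  by apply/funext => x /=; rewrite cons_rVK.
by rewrite product_measure1E// lte_mul_pinfty// ge0_fin_numE.
Qed.

HB.instance Definition _ := @Measure_isSigmaFinite.Build _ _ _ cons_measure
  cons_measure_sigma_finite.

End cons_measure.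

Fixpoint lebesgue_rV (R : realType) (d : nat) :
    {sigma_finite_measure set 'rV[R]_d -> \bar R} :=
  match d return {sigma_finite_measure set 'rV[R]_d -> \bar R} with
  | 0%N => \d_(0 : 'rV[R]_0)
  | d'.+1 => cons_measure (lebesgue_rV R d')
  end.

Section kernels.
Variables (R : realType) (d : nat).
Local Notation V := 'rV[R]_d.
Implicit Types (x y : V) (s : R).

Definition dotp x y : R := \sum_(i < d) x ord0 i * y ord0 i.

(* The Euclidean norm; `|x| on 'rV[R]_d is the sup norm. *)
Definition enorm x : R := Num.sqrt (dotp x x).

Definition psi s x : R := enorm x `^ (1 + s).

Definition Kgrad s x : V :=
  if x == 0 then 0 else ((1 + s) * enorm x `^ (s - 1)) *: x.

(* The integrand is nonnegative, so the value is +oo exactly when the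
   integral diverges. *)
Definition psi_conv s (mu : {measure set V -> \bar R}) x : \bar R :=
  (\int[mu]_y (psi s (x - y))%:E)%E.

Definition K_conv s (mu : {measure set V -> \bar R}) x : V :=
  \row_i (\int[mu]_y (Kgrad s (x - y) ord0 i))%R.

End kernels.

Section test_functions.
Variables (R : realType) (d : nat).
Local Notation V := 'rV[R]_d.
Local Notation C := R[i].
Implicit Types (f g : V -> C) (h : V -> R).

Definition re_part f : V -> R := fun x => complex.Re (f x).
Definition im_part f : V -> R := fun x => complex.Im (f x).

Definition partial (i : 'I_d) h : V -> R := fun x => 'D_(delta_mx ord0 i) h x.

Definition cpartial (i : 'I_d) f : V -> C :=
  fun x => (partial i (re_part f) x +i* partial i (im_part f) x)%C.

Definition iter_partial (l : seq 'I_d) h : V -> R := foldr partial h l.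

Definition smooth h : Prop := forall l x, differentiable (iter_partial l h) x.

Definition compact_support_in (T : zmodType) (U : set V) (v : V -> T) : Prop :=
  compact (closure [set x | v x != 0]) /\ closure [set x | v x != 0] `<=` U.

Definition test_function (U : set V) f : Prop :=
  [/\ smooth (re_part f), smooth (im_part f) & compact_support_in U f].

Definition test_field (xi : V -> V) : Prop :=
  (forall i, smooth (fun x => xi x ord0 i)) /\ compact_support_in setT xi.

Definition schwartz f : Prop :=
  [/\ smooth (re_part f), smooth (im_part f) &
    forall (l : seq 'I_d) (k : nat), exists M : R, forall x,
      enorm x ^+ k * `|iter_partial l (re_part f) x| <= M /\
      enorm x ^+ k * `|iter_partial l (im_part f) x| <= M].

(* [M] bounds the [N]-th of the norms generating the topology of the Schwartz
   space. *)
Definition schwartz_norm_le (N : nat) (M : R) f : Prop :=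
  forall (l : seq 'I_d) x, (size l <= N)%N ->
    (1 + enorm x) ^+ N * `|iter_partial l (re_part f) x| <= M /\
    (1 + enorm x) ^+ N * `|iter_partial l (im_part f) x| <= M.

End test_functions.

Section distributions.
Variables (R : realType) (d : nat).
Local Notation V := 'rV[R]_d.
Local Notation C := R[i].
Implicit Types (f g : V -> C) (mu : {measure set V -> \bar R}).

(* Distributions are represented by functionals on all functions; only their
   values on test functions matter, and equality is [eq_on_schwartz] or
   [eq_on_test]. *)
Definition functional := (V -> C) -> C.
Implicit Types T U : functional.

Definition tempered T : Prop :=
  (forall c f g, schwartz f -> schwartz g ->
     T (fun x => c * f x + g x) = c * T f + T g) /\
  exists (N : nat) (A : R), forall f (M : R),
    schwartz f -> schwartz_norm_le N M f -> `|T f| <= ((A * M)%:C)%C.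

Definition eq_on_schwartz T U : Prop := forall f, schwartz f -> T f = U f.

Definition eq_on_test (O : set V) T U : Prop :=
  forall f, test_function O f -> T f = U f.

Definition sub_functional T U : functional := fun f => T f - U f.

Definition cintegral mu (D : set V) f : C :=
  ((\int[mu]_(x in D) complex.Re (f x))%R +i*
   (\int[mu]_(x in D) complex.Im (f x))%R)%C.

Definition functional_of_measure mu : functional :=
  fun f => cintegral mu setT f.

Definition functional_of_fun (u : V -> \bar R) : functional :=
  fun f => cintegral (lebesgue_rV R d) setT (fun x => ((fine (u x))%:C)%C * f x).

(* The integrability clause bears on the extended-real function [u] itself, so
   that infinite values are not hidden by [fine]. *)
Definition tempered_fun (u : V -> \bar R) : Prop :=
  [/\ measurable_fun setT u,
      forall f, schwartz f ->
        (lebesgue_rV R d).-integrable setT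
          (fun x => u x * (complex.Re (f x))%:E)%E /\
        (lebesgue_rV R d).-integrable setT
          (fun x => u x * (complex.Im (f x))%:E)%E &
      tempered (functional_of_fun u)].

Definition expi (t : R) : C := (cos t +i* sin t)%C.

Definition fourier f : V -> C := fun xi =>
  cintegral (lebesgue_rV R d) setT (fun x => expi (- dotp x xi) * f x).

Definition fourier_measure mu : V -> C := fun xi =>
  cintegral mu setT (fun x => expi (- dotp x xi)).

Definition fourier_functional T : functional := fun f => T (fourier f).

End distributions.

Section riesz.
Variables (R : realType) (d : nat).
Local Notation V := 'rV[R]_d.
Local Notation C := R[i].
Local Notation leb := (lebesgue_rV R d).
Implicit Types (mu : {measure set V -> \bar R}) (f : V -> C).
Implicit Types (T F : functional R d) (a r s : R).

(* The surface measure of the unit sphere is d times the volume of the ball. *)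
Definition sphere_area : R := d%:R * fine (leb [set x | enorm x < 1]).

Definition fp_truncated s f (e : R) : C :=
  cintegral leb [set xi | e < enorm xi]
    (fun xi => ((enorm xi `^ (- d%:R - 1 - s))%:C)%C * f xi)
  - ((sphere_area / (1 + s) * e `^ (- 1 - s))%:C)%C * f 0.

Definition is_fp s f (z : C) : Prop :=
  complex.Re (fp_truncated s f e) @[e --> 0^'+] --> complex.Re z /\
  complex.Im (fp_truncated s f e) @[e --> 0^'+] --> complex.Im z.

(* [gamma s] is the nonzero constant such that the Fourier transform of [psi s]
   is [gamma s] times the finite part of |xi| ^ (- d - 1 - s). *)
Definition is_psi_fourier_constant (gamma : R -> C) : Prop :=
  forall s, 0 <= s < 1 -> gamma s != 0 /\
    forall f, schwartz f -> exists2 z, is_fp s f z &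
      fourier_functional (functional_of_fun (fun x => (psi s x)%:E)) f
      = gamma s * z.

Definition psi_conv_functional s mu : functional R d :=
  functional_of_fun (psi_conv s mu).

Definition admissible s mu : Prop := tempered_fun (psi_conv s mu).

(* The convolution with a signed finite measure is the difference of the
   convolutions with the two parts of its Jordan decomposition. *)
Definition frakP s T : Prop := tempered T /\
  exists (mu : {charge set V -> \bar R}) (P N : set V)
      (PN : hahn_decomposition mu P N),
    [/\ admissible s (jordan_pos PN), admissible s (jordan_neg PN) &
      eq_on_schwartz T (sub_functional
        (psi_conv_functional s (jordan_pos PN))
        (psi_conv_functional s (jordan_neg PN)))].

(* [T] is L_r (psi_a * mu). *)
Definition is_L_psi_conv (gamma : R -> C) r a mu T : Prop :=
  tempered T /\
  eq_on_schwartz (fourier_functional T)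
    (fun f => gamma a / gamma r *
       cintegral leb setT (fun xi =>
         ((enorm xi `^ (r - a))%:C)%C * fourier_measure mu xi * f xi)).

Definition interaction_field a r (omega phi : {measure set V -> \bar R}) x : V :=
  K_conv a omega x - K_conv r phi x.

(* F = psi_a * omega - psi_r * phi *)
Definition potential a r (omega phi : {measure set V -> \bar R}) :
    functional R d :=
  sub_functional (psi_conv_functional a omega) (psi_conv_functional r phi).

Definition weak_gradient F (G : V -> V) : Prop := forall i : 'I_d,
  (forall B : set V, compact B -> leb.-integrable B (fun x => (G x ord0 i)%:E)) /\
  forall f, test_function setT f ->
    F (cpartial i f) = - cintegral leb setT (fun x => ((G x ord0 i)%:C)%C * f x).

(* A weak gradient is determined only up to Lebesgue-null sets, which [phi] may
   charge; among its versions, those considered agree [phi]-almost everywhere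
   with the pointwise formula K_a * omega - K_r * phi. *)
Definition borel_gradient a r (omega phi : {measure set V -> \bar R})
    (G : V -> V) : Prop :=
  [/\ measurable_fun setT G, weak_gradient (potential a r omega phi) G &
      {ae phi, forall x, G x = interaction_field a r omega phi x}].

Definition zero_flux_stationary a r (omega phi : {measure set V -> \bar R}) :
    Prop :=
  forall xi : V -> V, test_field xi ->
    let flux x := dotp (xi x) (interaction_field a r omega phi x) in
    phi.-integrable setT (EFin \o flux) -> (\int[phi]_x flux x)%R = 0.

Definition vanishing_set mu : set V :=
  interior [set x | exists2 U, open_nbhs x U & mu U = 0%E].

Definition supported_in mu (S : set V) : Prop := mu (~` S) = 0%E.

End riesz.

(* Main.v *)
Require Import Defs.
From HB Require Import structures.
From mathcomp Require Import all_boot all_order all_algebra.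
From mathcomp Require Import all_classical all_reals all_analysis.
From mathcomp Require Import measurable_realfun.
From mathcomp Require Import complex.
From mathcomp Require Import ring lra.

Import Order.TTheory GRing.Theory Num.Theory.
Import numFieldNormedType.Exports.

Local Open Scope classical_set_scope.
Local Open Scope ring_scope.

Set Implicit Arguments.
Unset Strict Implicit.
Unset Printing Implicit Defensive.

(** By the definition of [L_r], on Schwartz functions the tempered distribution
    [L_r (psi_r * phi)] agrees with [phi] on every Fourier transform, and it
    suffices to see that Fourier transforms are dense for each Schwartz norm.
    For a real Schwartz function [g], Fubini and the Fourier transform of a
    Gaussian show that the Fourier transform of
    [exp (- e^2 |x|^2) * \int exp (i x.y) g(y) dy] is a constant times the average
    [\int g(x + e z) exp (- |z|^2 / 4) dz], which tends to a nonzero multiple of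
    [g] as [e] goes to 0; no Fourier inversion is needed.  Hence
    [L_r (psi_r * phi) = phi], so that [phi = Q - L_r F] always holds.  The zero-flux
    condition, tested on smooth bumps increasing to indicators of boxes, says
    that [K_a * omega - K_r * phi] vanishes [phi]-almost everywhere, and [phi]
    does not charge [Omega]. *)

(** * Differential calculus on row vectors *)

(** The relation defining [L_r] sees a functional only through Fourier transforms of Schwartz
    functions, so a large supply of explicit transforms is needed. The Gaussian factor makes the
    preimage visibly Schwartz: the undamped oscillatory integral of [g] has bounded derivatives of
    all orders, and the Gaussian supplies the decay. The price is that [g] is only reached
    approximately. The convergence is therefore quantitative: in each Schwartz norm the error is at
    most [e * C] for 0 < e <= 1, and the continuity bound of a tempered functional turns this into
    an inequality with right-hand side O(e).

    Complex exponentials are replaced by cosines with a free phase: shifting the phase gives real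
    and imaginary parts, accounts for differentiation, and absorbs coordinates split off in an
    induction on the dimension. Smoothness is always obtained from a class of functions closed under
    partial derivatives, and differentiability of parameter integrals from a quadratic remainder
    bound, which can be integrated directly. *)

Section norm_rV.
Variables (R : realType) (d : nat).
Implicit Type v : 'rV[R]_d.

Lemma coord_le_norm v i : `|v ord0 i| <= `|v|.
Proof.
have /mapP[j Hj ->] : `|v ord0 i| \in [seq `|v x.1 x.2| | x : 'I_1 * 'I_d].
  by apply/mapP; exists (ord0, i) => //=; rewrite mem_enum.
by rewrite [leRHS]/Num.norm /= mx_normrE; apply/bigmax_geP; right => /=; exists j.
Qed.

Lemma norm_rV_le v C : 0 <= C -> (forall i, `|v ord0 i| <= C) -> `|v| <= C.
Proof.
move=> C0 h; rewrite [leLHS]/Num.norm /= mx_normrE.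
by apply/bigmax_leP; split=> // -[i j] _ /=; rewrite (ord1 i).
Qed.

End norm_rV.

Section gradient.
Variables (R : realType) (d : nat).
Local Notation V := 'rV[R]_d.
Implicit Types (h g : V -> R) (dh dg : 'I_d -> V -> R).

(** Differentiability is packed with explicit partials because [smooth] iterates [partial]: the next
    derivative is taken of the functions [dh i], so they must be available as functions and not
    pointwise. *)
Definition has_grad h dh := forall x, differentiable h x /\
  forall i, partial i h x = dh i x.

Definition lin_rV (c : 'I_d -> R) (v : V) : R := \sum_i v ord0 i * c i.

Lemma lin_rV_is_linear c : linear (lin_rV c).
Proof.
move=> k u v; rewrite /lin_rV scaler_sumr -big_split/=; apply: eq_bigr => i _.
by rewrite !mxE mulrDl -mulrA.
Qed.

HB.instance Definition _ c :=
  GRing.isLinear.Build R V R _ (lin_rV c) (lin_rV_is_linear c).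

Lemma lin_rV_continuous c : continuous (lin_rV c).
Proof.
rewrite /lin_rV => x.
apply: (@cvg_big R _ +%R 0 predT (@add_continuous R) V (nbhs x)) => i _.
by apply: cvgM; [exact: coord_continuous|exact: cvg_cst].
Qed.

Lemma diff_quadratic_remainder h (x : V) (c : 'I_d -> R) (C : R) :
  (forall v : V, `|h (v + x) - h x - lin_rV c v| <= C * `|v| ^+ 2) ->
  differentiable h x /\ 'd h x = lin_rV c :> (V -> R).
Proof.
move=> hC.
have E : (h \o shift x : V -> R^o) =
    cst (h x) + (lin_rV c : V -> R^o) +o_ (0 : V) id.
  apply/eqaddoP => _/posnumP[e]; apply/nbhs_ballP.
  (* The sign of [C] is unknown; [|C| + 1] is a positive upper bound for it. *)
  exists (e%:num / (`|C| + 1)); first by rewrite /= divr_gt0// ltr_wpDl.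
  move=> v; rewrite -ball_normE/= sub0r normrN => /ltW vC.
  rewrite [X in `|X|](_ : _ = h (v + x) - h x - lin_rV c v); last first.
    by rewrite !fctE /= opprD addrA.
  apply: le_trans (hC v) _; rewrite expr2 mulrA ler_wpM2r//.
  have /ler_wpM2r : C <= `|C| + 1 by rewrite (le_trans (ler_norm _))// lerDl.
  move=> /(_ _ (normr_ge0 v))/le_trans; apply.
  by rewrite -ler_pdivlMl ?ltr_wpDl// mulrC.
have D := diff_unique (@lin_rV_continuous c) E.
by split=> //; apply/diff_locallyP; rewrite D; split=> //; exact: lin_rV_continuous.
Qed.

Lemma has_grad_diff h dh x (v : V) : has_grad h dh ->
  'd h x v = lin_rV (dh ^~ x) v.
Proof.
move=> /(_ x)[dhx Dh]; rewrite [in LHS](row_sum_delta v) linear_sum.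
by apply: eq_bigr => i _; rewrite linearZ/= -Dh /partial deriveE.
Qed.

(** The criterion used for functions given by integrals: unlike a limit of difference quotients, a
    remainder bound passes under the integral sign. The constant may depend on the point. *)
Lemma has_grad_quadratic h dh (C : V -> R) :
  (forall x v, `|h (v + x) - h x - lin_rV (dh ^~ x) v| <= C x * `|v| ^+ 2) ->
  has_grad h dh.
Proof.
move=> hC x; have [dhx Dh] := diff_quadratic_remainder (hC x).
split=> // i; rewrite /partial deriveE// Dh /lin_rV (bigD1 i)//= big1 ?addr0.
  by rewrite !mxE !eqxx mul1r.
by move=> j ji; rewrite !mxE (negbTE ji) andbF mul0r.
Qed.

Lemma has_gradP h : (forall x, differentiable h x) -> has_grad h (fun i => partial i h).
Proof. by move=> hd x; split. Qed.

Lemma has_grad_continuous h dh : has_grad h dh -> continuous h.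
Proof. by move=> H x; apply: differentiable_continuous; case: (H x). Qed.

Lemma has_grad_ext h dh dh' : (forall i x, dh i x = dh' i x) -> has_grad h dh ->
  has_grad h dh'.
Proof. by move=> E H x; have [D Dh] := H x; split=> // i; rewrite Dh. Qed.

Lemma has_grad_cst (k : R) : has_grad (cst k) (fun _ => cst 0).
Proof.
move=> x; split=> [|i]; first exact: differentiable_cst.
by rewrite /partial derive_cst.
Qed.

Lemma has_grad_coord j : has_grad (fun x => x ord0 j) (fun i => cst (i == j)%:R).
Proof.
apply: (@has_grad_quadratic _ _ (cst 0)) => x v.
rewrite mul0r /lin_rV (bigD1 j)//= eqxx mulr1 big1 ?addr0.
  by rewrite mxE addrK subrr normr0.
by move=> i /negbTE ->; rewrite mulr0.
Qed.

Lemma has_gradD h dh g dg : has_grad h dh -> has_grad g dg ->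
  has_grad (h \+ g) (fun i => dh i \+ dg i).
Proof.
move=> H G x; have [dh_ Dh] := H x; have [dg_ Dg] := G x; split.
  exact: differentiableD.
move=> i; rewrite /partial deriveD; [|exact: diff_derivable..].
by rewrite -/(partial i h x) -/(partial i g x) Dh Dg.
Qed.

Lemma has_gradM h dh g dg : has_grad h dh -> has_grad g dg ->
  has_grad (h \* g) (fun i x => dh i x * g x + h x * dg i x).
Proof.
move=> H G x; have [dh_ Dh] := H x; have [dg_ Dg] := G x; split.
  exact: differentiableM.
move=> i; rewrite /partial deriveM; [|exact: diff_derivable..].
by rewrite -/(partial i h x) -/(partial i g x) Dh Dg addrC [_ *: _]mulrC.
Qed.

Lemma has_grad_comp h dh (f df : R -> R) : has_grad h dh ->
  (forall t : R, is_derive t (1 : R) f (df t)) ->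
  has_grad (f \o h) (fun i x => df (h x) * dh i x).
Proof.
move=> H F x; have [dh_ Dh] := H x.
have F' : differentiable f (h x) by apply/derivable1_diffP.
split; first exact: differentiable_comp.
move=> i; rewrite /partial deriveE; last exact: differentiable_comp.
rewrite diff_comp//= diff1E// -deriveE//.
by rewrite -/(partial i h x) Dh derive1E derive_val [_ *: _]mulrC.
Qed.

Lemma derivable_segment h dh (x v : V) (t : R) : has_grad h dh ->
  is_derive t 1 (fun s : R => h (x + s *: v)) (lin_rV (dh ^~ (x + t *: v)) v).
Proof.
move=> H.
have S : is_diff t (cst x + (fun s : R => s *: v)) (0 + (fun s : R => s *: v)).
  exact: is_diffD.
move: S; rewrite add0r => S.
have [dhx _] := H (x + t *: v).
have D : differentiable (h \o (fun s : R => x + s *: v)) t.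
  by apply: differentiable_comp.
apply: DeriveDef; first exact/derivable1_diffP.
rewrite deriveE// diff_comp//= diff_val/= scale1r.
exact: has_grad_diff.
Qed.

Lemma MVT_rV h dh (x v : V) : has_grad h dh ->
  exists2 t, 0 <= t <= 1 & h (x + v) - h x = lin_rV (dh ^~ (x + t *: v)) v.
Proof.
move=> H.
have /(_ 0 1 ler01)[||t] := @MVT_segment R (fun s => h (x + s *: v))
    (fun s => lin_rV (dh ^~ (x + s *: v)) v).
- by move=> t _; exact: derivable_segment.
- apply: derivable_within_continuous => t _.
  by have [] := derivable_segment x v t H.
rewrite in_itv/= scale1r scale0r addr0 subr0 mulr1 => t01 E.
by exists t.
Qed.

Lemma lin_rV_le c (v : V) B : (forall i, `|c i| <= B) ->
  `|lin_rV c v| <= d%:R * B * `|v|.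
Proof.
move=> cB; rewrite /lin_rV (le_trans (ler_norm_sum _ _ _))//.
apply: (@le_trans _ _ (\sum_(i < d) B * `|v|)).
  apply: ler_sum => i _; rewrite normrM mulrC ler_pM//.
  exact: coord_le_norm.
by rewrite big_const_ord iter_addr_0 -mulrA mulr_natl.
Qed.

Lemma lin_rVB c c' (v : V) : lin_rV c v - lin_rV c' v = lin_rV (fun i => c i - c' i) v.
Proof. by rewrite /lin_rV -sumrB; apply: eq_bigr => i _; rewrite mulrBr. Qed.

Lemma lipschitz_rV h dh B : has_grad h dh -> (forall i x, `|dh i x| <= B) ->
  forall x v, `|h (x + v) - h x| <= d%:R * B * `|v|.
Proof.
by move=> H dB x v; have [t _ ->] := MVT_rV x v H; exact: lin_rV_le.
Qed.

(** The mean value theorem gives the increment as the gradient at an intermediate point x + t v, and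
    the Lipschitz bound compares it with the gradient at x. The factor [d] comes from summing
    coordinates against the sup norm. *)
Lemma taylor2_rV h dh L : has_grad h dh ->
  (forall i x v, `|dh i (x + v) - dh i x| <= L * `|v|) ->
  forall x v, `|h (v + x) - h x - lin_rV (dh ^~ x) v| <= d%:R * L * `|v| ^+ 2.
Proof.
move=> H dL x v; rewrite [v + x]addrC; have [t /andP[t0 t1] ->] := MVT_rV x v H.
rewrite lin_rVB; apply: le_trans (lin_rV_le _ (B := L * `|v|) _) _.
  move=> i; apply: le_trans (dL _ _ _) _.
  have L0 : 0 <= L * `|v| by exact: le_trans (dL i x v).
  rewrite normrZ mulrCA ger0_norm// -[leRHS]mul1r ler_wpM2r//.
by rewrite expr2 !mulrA.
Qed.

Lemma has_grad_partial h dh i : has_grad h dh -> partial i h = dh i.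
Proof. by move=> H; apply/funext => x; case: (H x). Qed.

(** A class whose members are differentiable with partials in the class contains every iterated
    partial of its members. Smoothness thus follows from one derivative computation, and the second
    conclusion lets bounds known on the class apply to all derivatives. *)
Lemma smooth_coind (C : (V -> R) -> Prop) :
  (forall h, C h -> exists2 dh, has_grad h dh & forall i, C (dh i)) ->
  forall h, C h -> smooth h /\ forall l, C (iter_partial l h).
Proof.
move=> CP h Ch; have Cl l : C (iter_partial l h).
  elim: l => //= i l /CP[dh H Cdh]; rewrite (has_grad_partial i H); exact: Cdh.
split=> // l x; have [dh H _] := CP _ (Cl l).
by case: (H x).
Qed.

Lemma smooth_iter_partial l h : smooth h -> smooth (iter_partial l h).
Proof. by move=> sh l' x; rewrite /iter_partial -foldr_cat; exact: sh. Qed.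

Lemma smooth_has_grad h : smooth h -> has_grad h (fun i => partial i h).
Proof. by move=> sh; apply: has_gradP => x; exact: (sh [::]). Qed.

Lemma smooth_continuous h : smooth h -> continuous h.
Proof. by move=> /smooth_has_grad/has_grad_continuous. Qed.

(** The combinations of generators in [M] with coefficients in [A], where [A] is closed under
    neither sums nor products: polynomial coefficients arise by nesting [span_mul]. By the Leibniz
    rule it suffices to differentiate [A] and [M] separately. *)
Inductive span (A M : (V -> R) -> Prop) : (V -> R) -> Prop :=
| span_gen m : M m -> span A M m
| span_add h g : span A M h -> span A M g -> span A M (h \+ g)
| span_mul a h : A a -> span A M h -> span A M (a \* h).

Lemma span_grad (A M : (V -> R) -> Prop) :
  (forall a, A a -> exists2 da, has_grad a da & forall i, A (da i)) ->
  (forall m, M m -> exists2 dm, has_grad m dm & forall i, span A M (dm i)) ->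
  forall h, span A M h -> exists2 dh, has_grad h dh & forall i, span A M (dh i).
Proof.
move=> AP MP h; elim=> {h}[m /MP//|h g _ [dh H Sh] _ [dg G Sg]|a h Aa Sh [dh H Sdh]].
  exists (fun i => dh i \+ dg i); first exact: has_gradD.
  by move=> i; apply: span_add.
have [da D Ada] := AP _ Aa.
exists (fun i => (da i \* h) \+ (a \* dh i)); first exact: has_gradM.
by move=> i; apply: span_add; apply: span_mul.
Qed.

End gradient.

(** * Real-valued integrable functions and differentiation under the integral sign *)

Section rintegrable.
Context {R : realType} {disp} {T : measurableType disp}.
Variable mu : {measure set T -> \bar R}.
Implicit Types f g : T -> R.

Definition rintegrable f := mu.-integrable setT (EFin \o f).

Lemma rintegrable_measurable f : rintegrable f -> measurable_fun setT f.
Proof. by move=> /measurable_int/measurable_EFinP. Qed.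

Lemma rintegrableD f g : rintegrable f -> rintegrable g ->
  rintegrable (fun x => f x + g x).
Proof. by move=> fi gi; exact: (integrableD measurableT fi gi). Qed.

Lemma rintegrableB f g : rintegrable f -> rintegrable g ->
  rintegrable (fun x => f x - g x).
Proof. by move=> fi gi; exact: (integrableB measurableT fi gi). Qed.

Lemma rintegrableZ k f : rintegrable f -> rintegrable (fun x => k * f x).
Proof. by move=> fi; exact: (integrableZl measurableT k fi). Qed.

Lemma rintegrable_abs f : rintegrable f -> rintegrable (fun x => `|f x|).
Proof. by move=> fi; exact: (integrable_abse fi). Qed.

Lemma rintegrable0 : rintegrable (fun=> 0).
Proof. exact: integrable0. Qed.

Lemma rintegrable_le f g : measurable_fun setT f ->
  (forall x, `|f x| <= g x) -> rintegrable g -> rintegrable f.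
Proof.
move=> mf fg; apply: le_integrable => //; first exact/measurable_EFinP.
by move=> x _; rewrite /= lee_fin (le_trans (fg x))// ler_norm.
Qed.

Lemma rintegrable_sum (I : Type) (s : seq I) (f : I -> T -> R) :
  (forall i, rintegrable (f i)) -> rintegrable (fun x => \sum_(i <- s) f i x).
Proof.
move=> fi; elim: s => [|i s IH].
  rewrite (_ : (fun _ => _) = fun=> 0); first exact: rintegrable0.
  by apply/funext => x; rewrite big_nil.
rewrite (_ : (fun _ => _) = fun x => f i x + \sum_(i <- s) f i x).
  exact: rintegrableD.
by apply/funext => x; rewrite big_cons.
Qed.

Lemma Rintegral_sum (I : Type) (s : seq I) (f : I -> T -> R) :
  (forall i, rintegrable (f i)) ->
  \int[mu]_x (\sum_(i <- s) f i x) = \sum_(i <- s) \int[mu]_x f i x.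
Proof.
move=> fi; elim: s => [|i s IH].
  rewrite big_nil; under eq_Rintegral do rewrite big_nil.
  by rewrite /Rintegral integral0.
rewrite big_cons -IH -RintegralD//; first last.
- exact: rintegrable_sum.
- exact: fi.
by apply: eq_Rintegral => x _; rewrite big_cons.
Qed.

Lemma Rintegral_abs_le f g : rintegrable f -> rintegrable g ->
  (forall x, `|f x| <= g x) -> `|\int[mu]_x f x| <= \int[mu]_x g x.
Proof.
move=> fi gi fg; apply: (le_trans (le_normr_Rintegral measurableT fi)).
by apply: le_Rintegral => //; exact: rintegrable_abs.
Qed.

End rintegrable.

Section under_integral.
Context {R : realType} {d : nat} {disp} {T : measurableType disp}.
Variable mu : {measure set T -> \bar R}.
Local Notation V := 'rV[R]_d.

(** The pointwise remainder is dominated by [B y * |v|^2]; integrating it gives the quadratic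
    remainder of the integral, with constant the integral of [B]. *)
Lemma has_grad_integral (h : V -> T -> R) (dh : 'I_d -> V -> T -> R) (B : T -> R) :
  (forall x, rintegrable mu (h x)) ->
  (forall i x, rintegrable mu (dh i x)) ->
  rintegrable mu B ->
  (forall x v y, `|h (v + x) y - h x y - lin_rV (fun i => dh i x y) v|
     <= B y * `|v| ^+ 2) ->
  has_grad (fun x => \int[mu]_y h x y) (fun i x => \int[mu]_y dh i x y).
Proof.
move=> ih idh iB hB.
apply: (@has_grad_quadratic _ _ _ _ (cst (\int[mu]_y B y))) => x v.
have il i : rintegrable mu (fun y => v ord0 i * dh i x y) by exact: rintegrableZ.
have -> : lin_rV (fun i => \int[mu]_y dh i x y) v =
    \int[mu]_y lin_rV (fun i => dh i x y) v.
  rewrite /lin_rV Rintegral_sum//.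
  by apply: eq_bigr => i _; rewrite RintegralZl//; exact: idh.
have ihh := rintegrableB (ih (v + x)) (ih x).
have isum := rintegrable_sum (index_enum 'I_d) il.
rewrite -RintegralB; [|by []|exact: ih..].
rewrite -RintegralB//.
rewrite mulrC -RintegralZl//.
apply: Rintegral_abs_le.
- exact: rintegrableB.
- exact: rintegrableZ.
- by move=> y; rewrite mulrC; exact: hB.
Qed.

End under_integral.

(** * Integration on row vectors *)

Section fubini_dominated.
Context {R : realType} {d1 d2} {T1 : measurableType d1} {T2 : measurableType d2}.
Variables (m1 : {sigma_finite_measure set T1 -> \bar R})
  (m2 : {sigma_finite_measure set T2 -> \bar R}).
Variables (f : T1 -> T2 -> R) (p : T1 -> R) (q : T2 -> R).
Hypothesis mf : measurable_fun setT (fun z : T1 * T2 => f z.1 z.2).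
Hypotheses (ip : rintegrable m1 p) (iq : rintegrable m2 q).
Hypothesis fpq : forall x y, `|f x y| <= p x * q y.

Lemma dominated_rintegrable1 x : rintegrable m2 (f x).
Proof.
apply: (rintegrable_le (g := fun y => p x * q y)).
- exact: (measurableT_comp mf (measurable_pair1 x)).
- exact: fpq.
- exact: rintegrableZ.
Qed.

Lemma dominated_rintegrable2 y : rintegrable m1 (f ^~ y).
Proof.
apply: (rintegrable_le (g := fun x => q y * p x)).
- exact: (measurableT_comp mf (measurable_pair2 y)).
- by move=> x; rewrite mulrC; exact: fpq.
- exact: rintegrableZ.
Qed.

(** By Tonelli: the inner integral of |f x y| is at most |p x| times the integral of |q|, which is
    integrable in x. *)
Lemma dominated_rintegrable : rintegrable (m1 \x m2)%E (fun z => f z.1 z.2).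
Proof.
apply/integrable12ltyP; first exact/measurable_EFinP.
apply: (@le_lt_trans _ _ (\int[m1]_x ((\int[m2]_y `|q y|) * `|p x|)%:E)%E).
  apply: ge0_le_integral => //.
  - by move=> x _; apply: integral_ge0 => y _; exact: abse_ge0.
  - apply: (measurable_fun_fubini_tonelli_F (fun z => `|(f z.1 z.2)%:E|%E)) => //.
    by apply/measurableT_comp => //; exact/measurable_EFinP.
  - by apply/measurable_EFinP; apply: (rintegrable_measurable (rintegrableZ _ (rintegrable_abs
    ip))).
  - move=> x _; rewrite mulrC -RintegralZl//; last exact: rintegrable_abs.
    rewrite /Rintegral fineK; last first.
      apply: integrable_fin_num => //; apply: rintegrableZ; exact: rintegrable_abs.
    apply: ge0_le_integral => //.
    + by apply/measurableT_comp => //; apply/measurable_EFinP/(rintegrable_measurable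
      (dominated_rintegrable1 x)).
    + by apply/measurable_EFinP; apply: (rintegrable_measurable (rintegrableZ _
      (rintegrable_abs iq))).
    + by move=> y _; rewrite /= lee_fin (le_trans (fpq x y))// -normrM ler_norm.
have /integrableP[_] := rintegrableZ (\int[m2]_y `|q y|) (rintegrable_abs ip).
apply: le_lt_trans; apply: ge0_le_integral => //.
- by move=> x _; rewrite lee_fin mulr_ge0// Rintegral_ge0.
- by apply/measurable_EFinP; apply: (rintegrable_measurable (rintegrableZ _ (rintegrable_abs
  ip))).
- by apply/measurableT_comp => //; apply/measurable_EFinP;
  apply: (rintegrable_measurable (rintegrableZ _ (rintegrable_abs ip))).
- by move=> x _; rewrite /= lee_fin ler_norm.
Qed.

Let FE x : (\int[m2]_y (f x y)%:E = (\int[m2]_y f x y)%:E)%E.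
Proof. by rewrite /Rintegral fineK//; apply: integrable_fin_num => //;
  exact: dominated_rintegrable1. Qed.

Let GE y : (\int[m1]_x (f x y)%:E = (\int[m1]_x f x y)%:E)%E.
Proof. by rewrite /Rintegral fineK//; apply: integrable_fin_num => //;
  exact: dominated_rintegrable2. Qed.

Lemma dominated_rintegrable_inner1 : rintegrable m1 (fun x => \int[m2]_y f x y).
Proof.
have := integrable_fubini_F dominated_rintegrable.
by apply: eq_integrable => // x _; rewrite /fubini_F FE.
Qed.

Lemma dominated_integral_prod :
  \int[(m1 \x m2)%E]_z f z.1 z.2 = \int[m1]_x \int[m2]_y f x y.
Proof.
rewrite {1}/Rintegral -(integral12_prod_meas1 dominated_rintegrable).
by rewrite /Rintegral; congr fine; apply: eq_integral => x _; rewrite /fubini_F FE.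
Qed.

Lemma dominated_Fubini :
  \int[m1]_x \int[m2]_y f x y = \int[m2]_y \int[m1]_x f x y.
Proof.
rewrite -dominated_integral_prod {1}/Rintegral -(integral21_prod_meas1 dominated_rintegrable).
by rewrite /Rintegral; congr fine; apply: eq_integral => x _; rewrite /fubini_G GE.
Qed.

End fubini_dominated.

Lemma dominated_rintegrable_inner2 {R : realType} {d1 d2}
  {T1 : measurableType d1} {T2 : measurableType d2}
  (m1 : {sigma_finite_measure set T1 -> \bar R})
  (m2 : {sigma_finite_measure set T2 -> \bar R})
  (f : T1 -> T2 -> R) (p : T1 -> R) (q : T2 -> R) :
  measurable_fun setT (fun z : T1 * T2 => f z.1 z.2) ->
  rintegrable m1 p -> rintegrable m2 q ->
  (forall x y, `|f x y| <= p x * q y) ->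
  rintegrable m2 (fun y => \int[m1]_x f x y).
Proof.
move=> mf ip iq fpq; apply: (dominated_rintegrable_inner1 (p := q) (q := p)) => //.
  exact: (measurableT_comp mf (@measurable_swap _ _ T2 T1)).
by move=> y x; rewrite mulrC; exact: fpq.
Qed.

Section image_measure.
Context {R : realType} {d1 d2} {X : measurableType d1} {Y : measurableType d2}.
Variables (mu : {measure set X -> \bar R}) (nu : {measure set Y -> \bar R}).
Variables (phi : X -> Y) (mphi : measurable_fun setT phi).
Hypothesis nuE : forall A, measurable A -> nu A = mu (phi @^-1` A).

Let pmu : {measure set Y -> \bar R} :=
  measure_function_pushforward__canonical__measure_function_Measure mu mphi.

(** Stated through [nuE] rather than for a literal pushforward, so as to cover both [cons_measure]
    and the change of variables t -> a + e t, where Lebesgue measure is the image of [e] times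
    itself. *)
Lemma ge0_integral_image F : measurable_fun setT F -> (forall y, 0 <= F y)%E ->
  (\int[nu]_y F y = \int[mu]_x F (phi x))%E.
Proof.
move=> mF F0; rewrite (eq_measure_integral pmu); last by move=> A mA _; exact: nuE.
by rewrite (ge0_integral_pushforward mphi)// preimage_setT.
Qed.

Lemma rintegrable_image F : measurable_fun setT F ->
  rintegrable mu (F \o phi) -> rintegrable nu F.
Proof.
move=> mF iF; apply/integrableP; split; first exact/measurable_EFinP.
rewrite ge0_integral_image//; first by case/integrableP : iF.
by apply/measurableT_comp => //; exact/measurable_EFinP.
Qed.

Lemma Rintegral_image F : measurable_fun setT F ->
  rintegrable mu (F \o phi) -> \int[nu]_y F y = \int[mu]_x F (phi x).
Proof.
move=> mF iF; rewrite /Rintegral.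
rewrite (eq_measure_integral pmu); last by move=> A mA _; exact: nuE.
congr fine; have := integral_pushforward mphi (mu := mu) (f := EFin \o F) (D := setT).
rewrite preimage_setT => ->//; exact/measurable_EFinP.
Qed.

End image_measure.

Section lebesgue_cons.
Context {R : realType}.
Local Notation leb := (lebesgue_rV R).

Let mcons n : measurable_fun [set: measurableTypeR R * 'rV[R]_n] (@cons_rV R n).
Proof. exact: measurable_cons_rV. Qed.

Lemma ge0_integral_cons n (F : 'rV[R]_n.+1 -> \bar R) :
  measurable_fun setT F -> (forall v, 0 <= F v)%E ->
  (\int[leb n.+1]_v F v = \int[lebesgue_measure]_t \int[leb n]_v F (cons_rV (t, v)))%E.
Proof.
move=> mF F0.
rewrite (ge0_integral_image (mu := ((@lebesgue_measure R) \x leb n)%E) (@mcons n))//.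
by rewrite fubini_tonelli1//; exact: measurableT_comp.
Qed.

Lemma integral_cons_dominated n (F : 'rV[R]_n.+1 -> R) (p : R -> R) (q : 'rV[R]_n -> R) :
  measurable_fun setT F -> rintegrable lebesgue_measure p -> rintegrable (leb n) q ->
  (forall t v, `|F (cons_rV (t, v))| <= p t * q v) ->
  rintegrable (leb n.+1) F /\
  \int[leb n.+1]_v F v = \int[lebesgue_measure]_t \int[leb n]_v F (cons_rV (t, v)).
Proof.
move=> mF ip iq Fpq.
have E : (fun z : R * 'rV[R]_n => F (cons_rV (z.1, z.2))) = F \o (@cons_rV R n).
  by apply/funext => -[].
have mG : measurable_fun setT (fun z : measurableTypeR R * 'rV[R]_n => F (cons_rV (z.1, z.2))).
  by rewrite E; exact: measurableT_comp.
have iG := dominated_rintegrable mG ip iq Fpq.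
split.
  by apply: (rintegrable_image (mu := ((@lebesgue_measure R) \x leb n)%E) (@mcons n)) => //;
    rewrite -E.
rewrite -(dominated_integral_prod mG ip iq Fpq).
rewrite (Rintegral_image (mu := ((@lebesgue_measure R) \x leb n)%E) (@mcons n))//.
Qed.

Lemma measurable_coord n (i : 'I_n) : measurable_fun setT (fun v : 'rV[R]_n => v ord0 i).
Proof. by apply: continuous_measurable_rV_R => v; exact: coord_continuous. Qed.

Lemma measurable_prod_coord n (q : R -> R) : measurable_fun setT q ->
  measurable_fun setT (fun v : 'rV[R]_n => \prod_i q (v ord0 i)).
Proof.
move=> mq; apply: measurable_prod => i _.
by apply: measurableT_comp => //; exact: measurable_coord.
Qed.

(** Induction on the dimension, one coordinate split off at a time. In dimension 0 [lebesgue_rV] is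
    a Dirac mass, so the empty product has integral 1. *)
Lemma integral_prod_coord n (q : R -> R) : (forall t, 0 <= q t) ->
  rintegrable lebesgue_measure q ->
  rintegrable (leb n) (fun v => \prod_i q (v ord0 i)) /\
  \int[leb n]_v (\prod_i q (v ord0 i)) = (\int[lebesgue_measure]_t q t) ^+ n.
Proof.
move=> q0 iq; elim: n => [|n [IHi IH]].
  have E : (fun v : 'rV[R]_0 => \prod_(i < 0) q (v ord0 i)) = cst 1.
    by apply/funext => v; rewrite big_ord0.
  rewrite E expr0; split; first exact: finite_measure_integrable_cst.
  by rewrite Rintegral_cst// mul1r/= /dirac/= indicT.
have mq := rintegrable_measurable iq.
have [||iP ->] := @integral_cons_dominated n (fun v => \prod_i q (v ord0 i)) q _
  (measurable_prod_coord _) iq IHi.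
- exact: mq.
- move=> t v; rewrite big_ord_recl cons_rV0/= ger0_norm; last first.
    by rewrite mulr_ge0// prodr_ge0.
  by under eq_bigr do rewrite cons_rVS.
split=> //.
under eq_Rintegral => t _.
  under eq_Rintegral => v _.
    rewrite big_ord_recl cons_rV0/=; under eq_bigr do rewrite cons_rVS/=; over.
  rewrite RintegralZl// IH; over.
by rewrite RintegralZr// exprS mulrC.
Qed.

(** Uniqueness of Lebesgue measure: the rescaled image measure gives each half-open interval its
    length. *)
Lemma lebesgue_affine (a e : R) (A : set R) : 0 < e -> measurable A ->
  (lebesgue_measure A = e%:E * lebesgue_measure ((fun t => a + e * t)%R @^-1` A))%E.
Proof.
move=> e0 mA.
have maff : measurable_fun [set: measurableTypeR R] (fun t => a + e * t : measurableTypeR R).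
  by apply: measurable_funD => //; exact: measurable_funM.
pose pmu : {measure set (measurableTypeR R) -> \bar R} :=
  measure_function_pushforward__canonical__measure_function_Measure (@lebesgue_measure R) maff.
pose nu : {measure set (measurableTypeR R) -> \bar R} :=  mscale (NngNum (ltW e0)) pmu.
rewrite (@lebesgue_measure_unique _ nu)// => _ [[x y]] _ <-.
have E : (fun t => a + e * t) @^-1` `]x, y] = `](x - a) / e, (y - a) / e]%classic.
  apply/seteqP; split=> t /=; rewrite !in_itv/= ltr_pdivrMr// ler_pdivlMr//;
  by rewrite ltrBlDl lerBrDl [t * e]mulrC.
transitivity (e%:E * lebesgue_measure ((fun t => a + e * t)%R @^-1` `]x, y]%classic))%E => //.
rewrite E.
rewrite !lebesgue_measure_itv/= !lte_fin ltr_pM2r ?invr_gt0// ltrD2r.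
case: ifPn => _; last by rewrite mule0.
by rewrite -!EFinD -EFinM -mulrBl opprB addrA subrK mulrC divfK// gt_eqF.
Qed.

Lemma ge0_integral_affine1 (a e : R) (F : R -> \bar R) : 0 < e ->
  measurable_fun setT F -> (forall t, 0 <= F t)%E ->
  (\int[lebesgue_measure]_t F t = e%:E * \int[lebesgue_measure]_t F (a + e * t)%R)%E.
Proof.
move=> e0 mF F0.
have maff : measurable_fun [set: measurableTypeR R] (fun t => a + e * t : measurableTypeR R).
  by apply: measurable_funD => //; exact: measurable_funM.
pose mu : {measure set (measurableTypeR R) -> \bar R} := mscale (NngNum (ltW e0))
  (@lebesgue_measure R).
rewrite (ge0_integral_image (mu := mu) maff)//; last first.
  by move=> A mA; rewrite /mu/= /mscale/= (lebesgue_affine a e0).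
rewrite ge0_integral_mscale//.
exact: (measurableT_comp mF maff).
Qed.

Lemma cons_rV_affine n (a : R) (b : 'rV[R]_n) (e t : R) (v : 'rV[R]_n) :
  cons_rV (a, b) + e *: cons_rV (t, v) = cons_rV (a + e * t, b + e *: v).
Proof.
apply/rowP => i; rewrite [LHS]mxE [X in _ + X]mxE.
by case: (unliftP ord0 i) => [j ->|->]; rewrite ?cons_rVS ?cons_rV0//= !mxE.
Qed.

Lemma cons_unconsK n (v : 'rV[R]_n.+1) : cons_rV (uncons_rV v) = v.
Proof.
apply/rowP => i.
case: (unliftP ord0 i) => [j ->|->]; rewrite ?cons_rVS ?cons_rV0//= mxE.
by congr (v _ _); apply: val_inj.
Qed.

Lemma measurable_affine n (a : 'rV[R]_n) (e : R) :
  measurable_fun setT (fun v : 'rV[R]_n => a + e *: v).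
Proof.
apply: continuous_measurable_rV_rV => v; apply: differentiable_continuous.
by apply: (differentiableD (f := cst a) (g := fun v => e *: v)).
Qed.

(** The one-dimensional substitution is applied to the first coordinate and the induction hypothesis
    to the others; each coordinate contributes one factor [e]. *)
Lemma ge0_integral_affine n (a : 'rV[R]_n) (e : R) (F : 'rV[R]_n -> \bar R) : 0 < e ->
  measurable_fun setT F -> (forall v, 0 <= F v)%E ->
  (\int[leb n]_v F v = (e ^+ n)%:E * \int[leb n]_v F (a + e *: v)%R)%E.
Proof.
move=> e0; elim: n => [|n IH] in a F *.
  move=> mF F0; rewrite expr0 mul1e; apply: eq_integral => v _.
  by rewrite (thinmx0 v) (thinmx0 (_ + _)).
move=> mF F0; rewrite !ge0_integral_cons//; last first.
  exact: (measurableT_comp mF (measurable_affine _ _)).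
rewrite -(cons_unconsK a); case: (uncons_rV a) => a0 b.
have mFc : measurable_fun [set: measurableTypeR R * 'rV[R]_n] (fun z => F (cons_rV z)).
  exact: (measurableT_comp mF (@mcons n)).
have mG := measurable_fun_fubini_tonelli_F (m2 := leb n) _ mFc (fun z => F0 _).
have FI t : (0 <= fubini_F (leb n) (fun z => F (cons_rV z)) t)%E by exact: integral_ge0.
rewrite [LHS](ge0_integral_affine1 a0 e0 mG FI).
rewrite exprS EFinM -muleA; congr *%E.
rewrite -ge0_integralZl//; first last.
- by rewrite lee_fin exprn_ge0// ltW.
- by move=> t _; exact: integral_ge0.
- rewrite (_ : (fun _ => _) = fubini_F (leb n) (fun z => F (cons_rV (a0,
  b) + e *: cons_rV z))) //.
  apply: (measurable_fun_fubini_tonelli_F (m2 := leb n)) => //.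
  apply: (measurableT_comp mF).
  exact: (measurableT_comp (measurable_affine _ _) (@mcons n)).
apply: eq_integral => t _; rewrite /fubini_F (IH b (fun v => F (cons_rV (a0 + e * t, v))));
  first last.
- by [].
- apply: (measurableT_comp mF (g := fun v => cons_rV (a0 + e * t, v))).
  exact: (measurableT_comp (@mcons n) (@measurable_pair1 _ _ (measurableTypeR R) _ (a0 + e *
    t))).
by congr (_ * _)%E; apply: eq_integral => v _; rewrite cons_rV_affine.
Qed.

Lemma Rintegral_affine n (a : 'rV[R]_n) (e : R) (F : 'rV[R]_n -> R) : 0 < e ->
  measurable_fun setT F -> rintegrable (leb n) (fun v => F (a + e *: v)) ->
  \int[leb n]_v F v = e ^+ n * \int[leb n]_v F (a + e *: v).
Proof.
move=> e0 mF iF; have mFE : measurable_fun setT (EFin \o F) by exact/measurable_EFinP.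
have ip := integrable_funepos measurableT iF.
have im := integrable_funeneg measurableT iF.
have EP : (\int[leb n]_v (EFin \o F)^\+ v =
    (e ^+ n)%:E * \int[leb n]_v (EFin \o (fun v => F (a + e *: v)%R))^\+ v)%E.
  rewrite (ge0_integral_affine a e0)//; last exact: measurable_funepos.
  by congr (_ * _)%E; apply: eq_integral => v _; rewrite !funeposE.
have EN : (\int[leb n]_v (EFin \o F)^\- v =
    (e ^+ n)%:E * \int[leb n]_v (EFin \o (fun v => F (a + e *: v)%R))^\- v)%E.
  rewrite (ge0_integral_affine a e0)//; last exact: measurable_funeneg.
  by congr (_ * _)%E; apply: eq_integral => v _; rewrite !funenegE.
rewrite /Rintegral integralE EP EN [in RHS]integralE.
have /fineK <- := integrable_fin_num measurableT ip.
have /fineK <- := integrable_fin_num measurableT im.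
by rewrite -!EFinM -!EFinB/= mulrBr.
Qed.

Lemma rintegrable_oneDsqrV : rintegrable lebesgue_measure (fun t : R => (oneDsqr t)^-1).
Proof.
have m1 : measurable_fun setT (fun t : R => (oneDsqr t)^-1).
  by apply: continuous_measurable_fun; exact: continuous_oneDsqrV.
apply/integrableP; split; first exact/measurable_EFinP.
have E (t : R) : (`|((EFin \o (fun t : R => (oneDsqr t)^-1)%R) t)| = ((oneDsqr t)^-1)%:E)%E.
  by rewrite /= ger0_norm.
under eq_integral => t _ do rewrite E.
rewrite ge0_symfun_integralT//=.
- rewrite (_ : [set x | _] = `[0, +oo[%classic); last first.
    by apply/seteqP; split => x/=; rewrite in_itv/= andbT.
  by rewrite integral0y_oneDsqr -EFinM ltry.
- exact: continuous_oneDsqrV.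
- by move=> t /=; rewrite /oneDsqr sqrrN.
Qed.

Lemma rintegrable_R (f : R -> R) (M : R) : measurable_fun setT f ->
  (forall t, (1 + t ^+ 2) * `|f t| <= M) -> rintegrable lebesgue_measure f.
Proof.
move=> mf fM; apply: (@rintegrable_le _ _ _ lebesgue_measure f (fun t => M * (oneDsqr t)^-1))
  => //.
  by move=> t; rewrite ler_pdivlMr ?(lt_le_trans ltr01)// mulrC; exact: fM.
exact/rintegrableZ/rintegrable_oneDsqrV.
Qed.

End lebesgue_cons.

(** * Rapidly decreasing functions *)

Section rapid_decay.
Context {R : realType} {n : nat}.
Local Notation V := 'rV[R]_n.
Implicit Types P Q : V -> R.

(** Decay without smoothness. The class is stable under multiplication by coordinates, which is what
    differentiating an oscillatory integral does to its density. *)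
Definition rapid P := measurable_fun setT P /\
  forall k, exists M, forall y, (1 + `|y|) ^+ k * `|P y| <= M.

(** The comparison function is the product of the (1 + y_i^2)^-1, integrable by
    [integral_prod_coord]. Each 1 + y_i^2 is at most (1 + |y|)^2, so [n * 2] extra powers of the
    weight pay for it. *)
Lemma rapid_rintegrable P k : rapid P ->
  rintegrable (lebesgue_rV R n) (fun y => (1 + `|y|) ^+ k * P y).
Proof.
move=> [mP hP]; have [M PM] := hP (n * 2 + k)%N.
have [//|iq _] := @integral_prod_coord R n (fun t => (oneDsqr t)^-1) _ rintegrable_oneDsqrV.
apply: (@rintegrable_le _ _ _ (lebesgue_rV R n) _ (fun v => M * \prod_i (oneDsqr (v ord0
  i))^-1)).
- apply: measurable_funM => //; apply: measurable_funX; apply: measurable_funD => //.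
  by apply: continuous_measurable_rV_R; exact: norm_continuous.
- move=> y; rewrite prodfV ler_pdivlMr; last first.
    by apply: prodr_gt0 => i _; rewrite (lt_le_trans ltr01).
  rewrite mulrC (le_trans _ (PM y))// normrM exprD -mulrA.
  rewrite ger0_norm ?exprn_ge0 ?addr_ge0//.
  rewrite ler_wpM2r ?mulr_ge0 ?exprn_ge0 ?addr_ge0//.
  have -> : (1 + `|y|) ^+ (n * 2) = \prod_(i < n) (1 + `|y|) ^+ 2.
    by rewrite prodr_const card_ord mulnC exprM.
  apply: ler_prod => i _; rewrite (le_trans ler01)//= /oneDsqr.
  have := coord_le_norm y i; move: (normr_ge0 y); rewrite -(real_normK (num_real (y ord0 i))).
  move: (normr_ge0 (y ord0 i)); nra.
- exact: rintegrableZ.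
Qed.

Lemma rapid_rintegrable0 P : rapid P -> rintegrable (lebesgue_rV R n) P.
Proof.
by move=> /(rapid_rintegrable 0); rewrite /rintegrable; under eq_fun do rewrite /= expr0 mul1r.
Qed.

Lemma rapid_le P Q (C : R) k : rapid Q -> measurable_fun setT P ->
  (forall y, `|P y| <= C * (1 + `|y|) ^+ k * `|Q y|) -> rapid P.
Proof.
move=> [_ hQ] mP PQ; split=> // l; have [M QM] := hQ (l + k)%N.
exists (`|C| * M) => y; apply: le_trans (ler_wpM2l (normr_ge0 C) (QM y)).
rewrite exprD -mulrA mulrCA ler_wpM2l ?exprn_ge0 ?addr_ge0// (le_trans (PQ y))//.
rewrite -mulrA ler_wpM2r ?mulr_ge0 ?exprn_ge0 ?addr_ge0//.
exact: ler_norm.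
Qed.

End rapid_decay.

(** * Gaussians and their Fourier transforms *)

Section gaussian1.
Context {R : realType}.
Implicit Types (b t w c : R).

(** For k > 0 write exp s as exp (s / k) ^ k and use exp u >= 1 + u: then k exp (s / k) >= k + s >=
    1 + s. *)
Lemma poly_expRN_bounded k (s : R) : 0 <= s -> (1 + s) ^+ k * expR (- s) <= k%:R ^+ k.
Proof.
case: k => [|k] s0; first by rewrite !expr0 mul1r -expR0 ler_expR oppr_le0.
rewrite expRN ler_pdivrMr ?expR_gt0//.
have -> : expR s = expR (s / k.+1%:R) ^+ k.+1.
  by rewrite -expRM_natl -mulr_natl mulrCA divff ?mulr1// pnatr_eq0.
rewrite -exprMn lerXn2r ?nnegrE ?addr_ge0 ?mulr_ge0 ?expR_ge0//.
apply: (@le_trans _ _ (k.+1%:R * (1 + s / k.+1%:R))); last first.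
  by rewrite ler_wpM2l// expR_ge1Dx.
by rewrite mulrDr mulrCA divff ?pnatr_eq0// !mulr1 lerD2r ler1n.
Qed.

Definition gaussb b t : R := expR (- (b * t ^+ 2)).

Lemma gaussb_ge0 b t : 0 <= gaussb b t. Proof. exact: expR_ge0. Qed.

Lemma continuous_gaussb b : continuous (gaussb b).
Proof.
move=> t; apply: (continuous_comp (f := fun t : R => - (b * t ^+ 2)) (g := expR)).
  by apply: cvgN; apply: cvgM; [exact: cvg_cst|exact: exprn_continuous].
exact: continuous_expR.
Qed.

Lemma gaussb_rapid b k : 0 < b -> exists M, forall t, (1 + `|t|) ^+ k * gaussb b t <= M.
Proof.
(* The constant is chosen so that 1 + |t| <= C (1 + b t^2), by way of 2 |t| <= 1 + t^2; the
   exponential bound is then applied at b t^2. *)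
move=> b0; pose C := 2 * (1 + b^-1); exists (C ^+ k * k%:R ^+ k) => t.
apply: (@le_trans _ _ (C ^+ k * ((1 + b * t ^+ 2) ^+ k * expR (- (b * t ^+ 2))))); last first.
  rewrite ler_wpM2l ?exprn_ge0//; last exact/poly_expRN_bounded/mulr_ge0/sqr_ge0/ltW.
  by rewrite mulr_ge0// addr_ge0// invr_ge0 ltW.
rewrite mulrA -exprMn ler_wpM2r ?expR_ge0// lerXn2r ?nnegrE ?addr_ge0//.
  apply: mulr_ge0; first by rewrite mulr_ge0// addr_ge0// invr_ge0 ltW.
  by rewrite addr_ge0// mulr_ge0 ?sqr_ge0// ltW.
have bi : 0 < b^-1 by rewrite invr_gt0.
have bt : 0 <= b * t ^+ 2 by rewrite mulr_ge0 ?sqr_ge0// ltW.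
have := sqr_ge0 (`|t| - 1); rewrite sqrrB real_normK ?num_real// expr1n mulr1 => h.
have := sqr_ge0 t.
have -> : C * (1 + b * t ^+ 2) = 2 * (1 + b * t ^+ 2 + b^-1 + t ^+ 2).
  by rewrite /C -!mulrA; congr (_ * _); field; rewrite gt_eqF.
rewrite -mulr_natl in h; lra.
Qed.

Lemma rintegrable_gauss_poly b (f : R -> R) k : 0 < b -> measurable_fun setT f ->
  (forall t, `|f t| <= (1 + `|t|) ^+ k) ->
  rintegrable lebesgue_measure (fun t => f t * gaussb b t).
Proof.
move=> b0 mf fk; have [M hM] := gaussb_rapid (k + 2) b0.
apply: (@rintegrable_R _ _ M).
  by apply: measurable_funM => //; apply: continuous_measurable_fun; exact: continuous_gaussb.
move=> t; apply: le_trans (hM t).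
rewrite normrM [`|gaussb _ _|]ger0_norm ?gaussb_ge0// mulrA ler_wpM2r ?gaussb_ge0//.
rewrite exprD mulrC ler_pM//.
  by rewrite addr_ge0 ?sqr_ge0.
rewrite -(real_normK (num_real t)); move: (normr_ge0 t); nra.
Qed.

Lemma gaussb_rintegrable b : 0 < b -> rintegrable lebesgue_measure (gaussb b).
Proof.
move=> b0; have := @rintegrable_gauss_poly b (cst 1) 0 b0.
rewrite (_ : (fun t => _) = gaussb b); last by apply/funext => t; rewrite mul1r.
by apply=> // t; rewrite normr1 expr0.
Qed.

Lemma derive_gaussb b t : is_derive t (1 : R) (gaussb b) (- (2 * b * t) * gaussb b t).
Proof.
have h : is_derive t (1 : R) (fun t : R => - (b * t ^+ 2)) (- (2 * b * t)).
  have -> : (fun t : R => - (b * t ^+ 2)) = (- b) *: ((@id R) ^+ 2 : R -> R).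
    by apply/funext => s; rewrite -[RHS]/(- b * s ^+ 2) mulNr.
  apply: is_derive_eq; rewrite /GRing.scale/= expr1; ring.
have := @is_derive1_comp R expR (fun t : R => - (b * t ^+ 2)) t _ _ (is_derive_expR _) h.
by rewrite mulrC.
Qed.

(** The fundamental theorem on growing intervals: the boundary terms vanish by the decay of [F], and
    dominated convergence passes to the whole line. *)
Lemma integral_derivativeT (F f : R -> R) :
  (forall t : R, is_derive t (1 : R) F (f t)) -> continuous f ->
  rintegrable lebesgue_measure f ->
  (exists M, forall t, (1 + `|t|) * `|F t| <= M) ->
  \int[lebesgue_measure]_t f t = 0.
Proof.
move=> dF cf fi [M FM].
have Fn (u : nat -> R) : (forall n, `|u n| = n.+1%:R) -> F (u n) @[n --> \oo] --> 0.
  move=> un; apply: norm_cvg0.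
  apply: (@squeeze_cvgr _ _ _ _ (cst 0) (fun n => M * (n.+1%:R)^-1)).
  - apply: nearW => n; rewrite normr_ge0/= ler_pdivlMr// mulrC.
    apply: le_trans (FM (u n)); rewrite un ler_wpM2r// lerDr//.
  - exact: cvg_cst.
  - rewrite -[X in _ --> X](mulr0 M); apply: cvgM; first exact: cvg_cst.
    exact: cvg_harmonic.
(* With [n.+1] the interval is never degenerate, as the fundamental theorem requires. *)
pose I n : set R := `[- n.+1%:R, n.+1%:R]%classic.
have mI n : measurable (I n : set (measurableTypeR R)) by exact: measurable_itv.
pose g n t : R := f t * \1_(I n) t.
have mf : measurable_fun [set: measurableTypeR R] f by exact: continuous_measurable_fun.
have mg n : measurable_fun [set: measurableTypeR R] (EFin \o g n).
  by apply/measurable_EFinP; apply: measurable_funM => //; exact: measurable_indic.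
have gE n : (\int[lebesgue_measure]_t (g n t)%:E = (F n.+1%:R - F (- n.+1%:R))%:E)%E.
  rewrite EFinB -(@continuous_FTC2 _ f).
  - rewrite [RHS]integral_mkcond; apply: eq_integral => t _.
    by rewrite /g /I indicE /patch; case: ifP => _; rewrite ?mulr1 ?mulr0.
  - by rewrite -subr_gt0 opprK -natrD ltr0n.
  - exact: continuous_subspaceT.
  - have cF : continuous F.
      by move=> t; apply/differentiable_continuous/derivable1_diffP.
    split; first by move=> t _.
    + exact/cvg_at_right_filter/cF.
    + exact/cvg_at_left_filter/cF.
  - by move=> t _; rewrite derive1E derive_val.
have gf t : (g n t)%:E @[n --> \oo] --> (f t)%:E.
  apply: cvg_near_cst; exists (Num.truncn `|t|).+1 => // n /= tn.
  rewrite /g indicE mem_set ?mulr1// /I/= in_itv/= -ler_norml.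
  apply: (le_trans (ltW (truncnS_gt _))); rewrite ler_nat.
  exact: (leq_trans tn).
have [] := @dominated_convergence _ _ _ (@lebesgue_measure R) setT measurableT
  (fun n => EFin \o g n) (EFin \o f) (fun t => `|f t|%:E) mg.
- exact/measurable_EFinP.
- by apply: aeW => t _; exact: gf.
- exact: rintegrable_abs.
- apply: aeW => t n _; rewrite /= lee_fin /g normrM ler_piMr//.
  by rewrite indicE; case: (_ \in _); rewrite ?normr1 ?normr0.
move=> _ _ h; apply/EFin_inj.
rewrite /Rintegral fineK; last exact: integrable_fin_num.
rewrite -(cvg_lim _ h)//; apply/cvg_lim => //.
rewrite [X in X @ _ --> _](_ : _ = fun n => (F n.+1%:R - F (- n.+1%:R))%:E); last first.
  by apply/funext => n; rewrite -gE.
apply: cvg_EFin; first exact: nearW.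
rewrite -[X in _ --> X](subr0 0); apply: cvgB.
  by apply: Fn => n; rewrite normr_nat.
by apply: Fn => n; rewrite normrN normr_nat.
Qed.

Lemma normrX_le_add1 (t : R) k : `|t ^+ k| <= (1 + `|t|) ^+ k.
Proof. by rewrite normrX lerXn2r ?nnegrE ?addr_ge0// lerDr. Qed.

Lemma continuous_cos_affine w c : continuous (fun t : R => cos (t * w + c)).
Proof.
move=> t; apply: (continuous_comp (f := fun t : R => t * w + c) (g := cos));
  last exact: continuous_cos.
by apply: cvgD; [apply: cvgM; [exact: cvg_id|exact: cvg_cst]|exact: cvg_cst].
Qed.

Lemma measurable_cos_affine w c : measurable_fun setT (fun t : R => cos (t * w + c)).
Proof. by apply: continuous_measurable_fun; exact: continuous_cos_affine. Qed.

(** Sines become cosines with a shifted phase, so every statement below concerns the single family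
    cos (t w + c). *)
Lemma sin_cosB (x : R) : sin x = cos (x - pi / 2).
Proof. by rewrite cosB cos_pihalf sin_pihalf mulr0 add0r mulr1. Qed.

Lemma cos_gauss_rintegrable w c k : rintegrable lebesgue_measure
  (fun t : R => t ^+ k * cos (t * w + c) * gaussb 1 t).
Proof.
apply: (rintegrable_gauss_poly (k := k)) => //.
  by apply: measurable_funM; [exact: measurable_funX|exact: measurable_cos_affine].
by move=> t; rewrite normrM -[leRHS]mulr1 ler_pM ?cos_max// normrX_le_add1.
Qed.

Lemma is_derive_affine w c t : is_derive t (1 : R) (fun t : R => t * w + c) w.
Proof.
have -> : (fun t : R => t * w + c) = w *: (@id R) + cst c.
  by apply/funext => s; rewrite -[RHS]/(w * s + c) mulrC.
by apply: is_derive_eq; rewrite /GRing.scale/=; ring.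
Qed.

Let K w c := \int[lebesgue_measure]_t (cos (t * w + c) * gaussb 1 t).

Lemma cos_gauss_rintegrable0 w c :
  rintegrable lebesgue_measure (fun t : R => cos (t * w + c) * gaussb 1 t).
Proof.
have := cos_gauss_rintegrable w c 0.
by rewrite (_ : (fun _ => _) = fun t : R => cos (t * w + c) * gaussb 1 t)//; apply/funext => t;
  rewrite expr0 mul1r.
Qed.

(** The derivative of sin (t w + c) exp (- t^2) has integral zero over the line; its two terms are
    the two sides. *)
Lemma gauss_ibp w c : w * K w c = 2 * \int[lebesgue_measure]_t (t * cos (t * w + c - pi / 2) *
  gaussb 1 t).
Proof.
pose f t : R := w * (cos (t * w + c) * gaussb 1 t) - 2 * (t * cos (t * w + c - pi / 2) * gaussb
  1 t).
have i0 := cos_gauss_rintegrable0 w c.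
have i1 : rintegrable lebesgue_measure (fun t : R => t * cos (t * w + c - pi / 2) * gaussb 1 t).
  have := cos_gauss_rintegrable w (c - pi / 2) 1.
  by rewrite (_ : (fun _ => _) = fun t : R => t * cos (t * w + c - pi / 2) * gaussb 1 t)//;
    apply/funext => t; rewrite expr1 addrA.
suff : \int[lebesgue_measure]_t f t = 0.
  rewrite RintegralB//; [|exact: rintegrableZ..].
  by rewrite !RintegralZl// => /eqP; rewrite subr_eq0 => /eqP.
apply: (@integral_derivativeT (fun t => sin (t * w + c) * gaussb 1 t)).
- move=> t.
  have hs := @is_derive1_comp R sin (fun t : R => t * w + c) t _ _ (is_derive_sin _)
    (is_derive_affine w c t).
  have hg := derive_gaussb 1 t.
  have h := is_deriveM hs hg.
  rewrite (_ : (fun t => _) = (sin \o (fun t : R => t * w + c)) * gaussb 1)//.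
  apply: is_derive_eq; rewrite /f -sin_cosB /GRing.scale/=; ring.
- have cc c' := @continuous_cos_affine w c'; have cg := @continuous_gaussb 1.
  move=> t; apply: cvgB; apply: cvgM; try exact: cvg_cst.
    by apply: cvgM; [exact: cc|exact: cg].
  apply: cvgM; last exact: cg.
  apply: cvgM; first exact: cvg_id.
  rewrite (_ : (fun t : R => cos (t * w + c - pi / 2)) =
    (fun t : R => cos (t * w + (c - pi / 2)))); first by rewrite -addrA;
    exact: (@continuous_cos_affine w (c - pi / 2) t).
  by apply/funext => x; rewrite addrA.
- by apply: rintegrableB; apply: rintegrableZ.
- have [M hM] := @gaussb_rapid 1 1 ltr01; exists M => t; apply: le_trans (hM t).
  rewrite expr1 ler_wpM2l ?addr_ge0// normrM [`|gaussb _ _|]ger0_norm ?gaussb_ge0//.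
  by rewrite ler_piMl ?gaussb_ge0// sin_max.
Qed.

(** Differentiating in [w] and integrating by parts yields K' = - (w / 2) K; the solution is fixed
    by its value at 0, the Gaussian integral. *)
Lemma gauss_fourier1 w c : K w c = cos c * (Num.sqrt pi * gaussb (1 / 4) w).
Proof.
have dK (v : R) : is_derive v (1 : R) (fun v => K v c) (- (v / 2) * K v c).
  pose F (x t : R) := cos (t * x + c) * gaussb 1 t.
  have dF x t : is_derive x (1 : R) (F ^~ t) (- (t * cos (t * x + c - pi / 2) * gaussb 1 t)).
    have ha := is_derive_affine t c x.
    have hc := @is_derive1_comp R cos _ x _ _ (is_derive_cos _) ha.
    rewrite (_ : F ^~ t = gaussb 1 t *: (cos \o (fun x => x * t + c))); last first.
      by apply/funext => y; rewrite /F mulrC [t * y]mulrC.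
    apply: is_derive_eq; rewrite -[t * x]mulrC -sin_cosB /GRing.scale/=; ring.
  have dFE x t : partial1of2 F x t = - (t * cos (t * x + c - pi / 2) * gaussb 1 t).
    by rewrite partial1of2E derive_val.
  have i1 x : rintegrable lebesgue_measure (fun t : R => t * cos (t * x + c - pi / 2) * gaussb
    1 t).
    have := cos_gauss_rintegrable x (c - pi / 2) 1.
    by rewrite (_ : (fun _ => _) = fun t : R => t * cos (t * x + c - pi / 2) * gaussb 1 t)//;
      apply/funext => t; rewrite expr1 addrA.
  (* Any neighbourhood of [v] serves, since the dominating function |t| exp (- t^2) does not involve
     the parameter. *)
  have vI : v \in `](v - 1), (v + 1)[ by rewrite in_itv/= ltrDl ltrBlDr ltrDl ltr01.
  have iF x : rintegrable lebesgue_measure (F x) by exact: cos_gauss_rintegrable0.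
  have iG : rintegrable lebesgue_measure (fun t : R => `|t| * gaussb 1 t).
    by apply: (rintegrable_gauss_poly (k := 1)) => // t; rewrite normr_id expr1 lerDr.
  have bG x t : `|partial1of2 F x t| <= `|t| * gaussb 1 t.
    rewrite dFE normrN 2!normrM [`|gaussb _ _|]ger0_norm ?gaussb_ge0//.
    by rewrite ler_wpM2r ?gaussb_ge0// ler_piMr// cos_max.
  have G0 (t : R) : 0 <= `|t| * gaussb 1 t by rewrite mulr_ge0 ?gaussb_ge0.
  apply: DeriveDef.
    apply: (derivable_under_integral measurableT vI (fun x _ => iF x) _ G0 iG (fun x t _ _ =>
      bG x t)).
    by move=> x t _ _; have [] := dF x t.
  rewrite -derive1E (differentiation_under_integral measurableT vI (fun x _ => iF x) _ G0 iG
    (fun x t _ _ => bG x t)); last first.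
    by move=> x t _ _; have [] := dF x t.
  under eq_Rintegral do rewrite dFE -mulN1r.
  rewrite RintegralZl//; last exact: i1.
  have := gauss_ibp v c; lra.
(* [gaussb (- (1 / 4)) v] is exp (v^2 / 4), the integrating factor of the differential equation. *)
pose G (v : R) := K v c * gaussb (- (1 / 4)) v.
have Gw : G w = G 0.
  apply: is_derive_0_is_cst => u.
  have hg := derive_gaussb (- (1 / 4)) u.
  have h := is_deriveM (dK u) hg.
  rewrite (_ : G = (fun v => K v c) * gaussb (- (1 / 4)))//.
  by apply: is_derive_eq; rewrite /GRing.scale/=; field.
have E0 : G 0 = cos c * Num.sqrt pi.
  rewrite /G /gaussb expr0n/= mulr0 oppr0 expR0 mulr1 /K.
  under eq_Rintegral do rewrite mulr0 add0r.
  have iG : rintegrable lebesgue_measure (gaussb 1).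
    exact: gaussb_rintegrable.
  rewrite RintegralZl//; congr (_ * _).
  rewrite /Rintegral (_ : (fun t => _) = fun t => (gauss_fun t)%:E) ?integralT_gauss//.
  by apply/funext => t; rewrite /gaussb mul1r.
have : G w * gaussb (1 / 4) w = cos c * Num.sqrt pi * gaussb (1 / 4) w by rewrite Gw E0.
rewrite /G -mulrA /gaussb -expRD mulNr opprK addrN expR0 mulr1 => ->.
by rewrite -mulrA.
Qed.

End gaussian1.

Section gaussian.
Context {R : realType} {n : nat}.
Local Notation V := 'rV[R]_n.

(** The product form factors along [cons_rV], as inductions on the dimension require; [gaussVE]
    gives the exponential of the squared Euclidean norm. *)
Definition gaussV (b : R) (v : V) : R := \prod_i gaussb b (v ord0 i).

Lemma gaussV_gt0 b v : 0 < gaussV b v.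
Proof. by apply: prodr_gt0 => i _; exact: expR_gt0. Qed.

Lemma gaussV_ge0 b v : 0 <= gaussV b v.
Proof. exact/ltW/gaussV_gt0. Qed.

Lemma measurable_gaussV b : measurable_fun setT (gaussV b).
Proof.
by apply: measurable_prod_coord; apply: continuous_measurable_fun; exact: continuous_gaussb.
Qed.

Lemma norm_le_prod_coord (v : V) : 1 + `|v| <= \prod_i (1 + `|v ord0 i|).
Proof.
have p1 (P : pred 'I_n) : 1 <= \prod_(i | P i) (1 + `|v ord0 i|).
  elim/big_ind : _ => // [x y x1 y1|i _]; last by rewrite lerDl.
  by rewrite -[1]mulr1 ler_pM.
rewrite -lerBrDl; apply: norm_rV_le => [|i]; first by rewrite subr_ge0.
rewrite lerBrDl (bigD1 i)//= -[leLHS]mulr1 ler_wpM2l// addr_ge0//.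
Qed.

Lemma gaussV_rapid b : 0 < b -> rapid (gaussV b).
Proof.
move=> b0; split; first exact: measurable_gaussV.
move=> k; have [M hM] := @gaussb_rapid R b k b0.
exists (M ^+ n) => v; rewrite ger0_norm ?gaussV_ge0//.
apply: (@le_trans _ _ (\prod_i ((1 + `|v ord0 i|) ^+ k * gaussb b (v ord0 i)))).
  rewrite big_split/= prodrXl ler_wpM2r ?gaussV_ge0//.
  rewrite lerXn2r ?nnegrE ?addr_ge0 ?norm_le_prod_coord//.
  by apply: prodr_ge0 => i _; rewrite addr_ge0.
rewrite -[n in M ^+ n]card_ord -prodr_const; apply: ler_prod => i _.
by rewrite hM mulr_ge0 ?exprn_ge0 ?addr_ge0 ?gaussb_ge0.
Qed.

End gaussian.

Section gaussian_fourier.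
Context {R : realType}.

Lemma dotp_cons n (x y : R * 'rV[R]_n) :
  dotp (cons_rV x) (cons_rV y) = x.1 * y.1 + dotp x.2 y.2.
Proof.
rewrite /dotp big_ord_recl !cons_rV0; congr (_ + _).
by apply: eq_bigr => i _; rewrite !cons_rVS.
Qed.

Lemma gaussV_cons n b (x : R * 'rV[R]_n) :
  gaussV b (cons_rV x) = gaussb b x.1 * gaussV b x.2.
Proof.
rewrite /gaussV big_ord_recl cons_rV0; congr (_ * _).
by apply: eq_bigr => i _; rewrite cons_rVS.
Qed.

Lemma has_grad_dotp n (w : 'rV[R]_n) c :
  has_grad (fun v => dotp v w + c) (fun i => cst (w ord0 i)).
Proof.
apply: (@has_grad_quadratic _ _ _ _ (cst 0)) => x v; rewrite mul0r.
have -> : dotp (v + x) w = dotp v w + dotp x w.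
  by rewrite /dotp -big_split; apply: eq_bigr => i _; rewrite mxE mulrDl.
by rewrite [_ - _ - _](_ : _ = 0) ?normr0//= /lin_rV -/(dotp v w); ring.
Qed.

Lemma has_grad_cos_dotp n (w : 'rV[R]_n) c :
  has_grad (fun v => cos (dotp v w + c))
           (fun i v => cos (dotp v w + (c + pi / 2)) * w ord0 i).
Proof.
have := has_grad_comp (has_grad_dotp w c) (fun t => is_derive_cos t).
apply: has_grad_ext => i x /=; congr (_ * _).
by rewrite addrA cosD cos_pihalf sin_pihalf mulr0 mulr1 sub0r.
Qed.

Lemma measurable_cos_dotp n (w : 'rV[R]_n) c :
  measurable_fun setT (fun v => cos (dotp v w + c)).
Proof.
by apply: continuous_measurable_rV_R; exact: has_grad_continuous (has_grad_cos_dotp w c).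
Qed.

(** Induction on the dimension for all phases at once: with the first coordinate [t] fixed, its
    contribution t w0 joins the phase, so no addition formula is needed. *)
Lemma gauss_fourier n (w : 'rV[R]_n) c :
  \int[lebesgue_rV R n]_v (cos (dotp v w + c) * gaussV 1 v) =
  cos c * (Num.sqrt pi ^+ n * gaussV (1 / 4) w).
Proof.
elim: n => [|n IH] in w c *.
  rewrite /gaussV big_ord0 expr0 !mulr1.
  under eq_Rintegral do rewrite /gaussV big_ord0 mulr1 /dotp big_ord0 add0r.
  by rewrite Rintegral_cst//= /dirac/= indicT mulr1.
rewrite -(cons_unconsK w); case: (uncons_rV w) => w0 w'.
have ig := @gaussb_rintegrable R 1 ltr01.
have iG : rintegrable (lebesgue_rV R n) (gaussV 1).
  exact/rapid_rintegrable0/gaussV_rapid.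
have [||_ ->] := @integral_cons_dominated R n
  (fun v => cos (dotp v (cons_rV (w0, w')) + c) * gaussV 1 v) _ _ _ ig iG.
- by apply: measurable_funM; [exact: measurable_cos_dotp|exact: measurable_gaussV].
- move=> t v; rewrite gaussV_cons/= normrM -[leRHS]mul1r ler_pM ?cos_max//.
  by rewrite ger0_norm// mulr_ge0 ?gaussb_ge0 ?gaussV_ge0.
transitivity (\int[lebesgue_measure]_t
    ((Num.sqrt pi ^+ n * gaussV (1 / 4) w') * (cos (t * w0 + c) * gaussb 1 t))).
  apply: eq_Rintegral => t _.
  transitivity (\int[lebesgue_rV R n]_v (gaussb 1 t * (cos (dotp v w' + (t * w0 + c)) * gaussV
    1 v))).
    apply: eq_Rintegral => v _; rewrite gaussV_cons dotp_cons/=.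
    by rewrite mulrCA; congr (_ * (cos _ * _)); rewrite addrCA addrA.
  rewrite RintegralZl//; first by rewrite IH; ring.
  apply: (rintegrable_le (g := gaussV 1)) => //.
    by apply: measurable_funM; [exact: measurable_cos_dotp|exact: measurable_gaussV].
  move=> v; rewrite normrM -[leRHS]mul1r ler_pM ?cos_max//.
  by rewrite ger0_norm ?gaussV_ge0.
rewrite RintegralZl//; last exact: cos_gauss_rintegrable0.
by rewrite gauss_fourier1 gaussV_cons/= exprS; ring.
Qed.

End gaussian_fourier.

(** * Schwartz functions *)

Section rschwartz.
Context {R : realType} {d : nat}.
Local Notation V := 'rV[R]_d.
Implicit Types (g h P : V -> R).

Definition rschwartz g := smooth g /\
  forall l k, exists M, forall x, (1 + `|x|) ^+ k * `|iter_partial l g x| <= M.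

Lemma norm_le_enorm (x : V) : `|x| <= enorm x.
Proof.
apply: norm_rV_le => [|i]; first exact: sqrtr_ge0.
rewrite -sqrtr_sqr ler_sqrt ?sumr_ge0//; last by move=> j _; rewrite -expr2 sqr_ge0.
rewrite /dotp (bigD1 i)//= -expr2 lerDl sumr_ge0// => j _.
by rewrite -expr2 sqr_ge0.
Qed.

Lemma enorm_ge0 (x : V) : 0 <= enorm x. Proof. exact: sqrtr_ge0. Qed.

Lemma dotp_sqr_le (x : V) : dotp x x <= d%:R * `|x| ^+ 2.
Proof.
apply: (@le_trans _ _ (\sum_(i < d) `|x| ^+ 2)).
  apply: ler_sum => i _; rewrite -expr2 -(real_normK (num_real (x ord0 i))).
  by rewrite lerXn2r ?nnegrE ?normr_ge0// coord_le_norm.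
by rewrite big_const_ord iter_addr_0 mulr_natl.
Qed.

Lemma enorm_le_norm (x : V) : enorm x <= d%:R * `|x|.
Proof.
rewrite -[leRHS]ger0_norm ?mulr_ge0// -sqrtr_sqr ler_wsqrtr//.
rewrite (le_trans (dotp_sqr_le x))// exprMn ler_wpM2r ?sqr_ge0// -natrX ler_nat.
by case: (d) => // m; rewrite expnS leq_pmulr// expn_gt0.
Qed.

Lemma one_enorm_le (x : V) : 1 + enorm x <= d.+1%:R * (1 + `|x|).
Proof.
have := enorm_le_norm x; rewrite -natr1; have := normr_ge0 x.
have : 0 <= d%:R :> R by []. nra.
Qed.

Lemma smooth_cst0 : smooth (fun _ : V => 0 : R) /\
  forall l, iter_partial l (fun _ : V => 0 : R) = fun=> 0.
Proof.
apply: (@smooth_coind _ _ (fun h => h = fun=> 0)) => // h ->.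
by exists (fun _ => cst 0) => //; exact: has_grad_cst.
Qed.

Lemma rschwartz0 : rschwartz (fun=> 0).
Proof.
have [s E] := smooth_cst0; split=> // l k; exists 0 => x.
by rewrite E normr0 mulr0.
Qed.

(** The weights are exchanged both ways: (1 + |x|)^k <= 2^k (1 + enorm x ^ k), which uses the
    exponents 0 and k, and enorm x <= d |x|. *)
Lemma schwartzE (f : V -> R[i]) :
  schwartz f <-> rschwartz (re_part f) /\ rschwartz (im_part f).
Proof.
have S (a b : V -> R) : (forall k, exists M, forall x,
  enorm x ^+ k * `|a x| <= M /\ enorm x ^+ k * `|b x| <= M) <->
   (forall k, exists M, forall x, (1 + `|x|) ^+ k * `|a x| <= M) /\
   (forall k, exists M, forall x, (1 + `|x|) ^+ k * `|b x| <= M).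
  split.
    move=> H; suff T (c : V -> R) : (forall k, exists M, forall x,
      enorm x ^+ k * `|c x| <= M) ->
        (forall k, exists M, forall x, (1 + `|x|) ^+ k * `|c x| <= M).
      split; apply: T => k; have [M hM] := H k; exists M => x; by case: (hM x).
    move=> {}H k; have [M0 H0] := H 0%N; have [M1 H1] := H k.
    exists (2 ^+ k * (M0 + M1)) => x.
    apply: (@le_trans _ _ (2 ^+ k * (enorm x ^+ 0 * `|c x| + enorm x ^+ k * `|c x|)));
      last first.
      by rewrite ler_wpM2l ?exprn_ge0// lerD.
    rewrite -mulrDl mulrA ler_wpM2r// expr0.
    apply: (@le_trans _ _ ((2 * Num.max 1 (enorm x)) ^+ k)).
      rewrite lerXn2r ?nnegrE ?addr_ge0 ?mulr_ge0 ?le_max ?ler01//.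
      by rewrite mulr2n mulrDl !mul1r lerD// ?le_max ?lexx// norm_le_enorm orbT.
    rewrite exprMn ler_wpM2l ?exprn_ge0// maxEle; case: ifP => _.
      by rewrite lerDr.
    by rewrite expr1n lerDl exprn_ge0// enorm_ge0.
  move=> [Ha Hb] k; have [M0 H0] := Ha k; have [M1 H1] := Hb k.
  exists (d%:R ^+ k * (`|M0| + `|M1|)) => x.
  suff T (c : V -> R) M : (1 + `|x|) ^+ k * `|c x| <= M ->
    enorm x ^+ k * `|c x| <= d%:R ^+ k * M.
    split; [apply: le_trans (T _ _ (H0 x)) _|apply: le_trans (T _ _ (H1 x)) _];
      rewrite ler_wpM2l ?exprn_ge0// (le_trans (ler_norm _))// ?lerDl ?lerDr//.
  move=> H; rewrite (le_trans _ (ler_wpM2l _ H)) ?exprn_ge0//.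
  rewrite mulrA -exprMn ler_wpM2r// lerXn2r ?nnegrE ?enorm_ge0 ?mulr_ge0 ?addr_ge0//.
  by rewrite (le_trans (enorm_le_norm x))// ler_wpM2l// lerDr.
split.
  move=> [s1 s2 H]; have H' l := (S _ _).1 (H l).
  by split; split=> // l; case: (H' l).
move=> [[s1 H1] [s2 H2]]; split=> // l; apply/(S _ _).2.
by split; [exact: H1|exact: H2].
Qed.

Lemma rschwartz_iter_partial l g : rschwartz g -> rschwartz (iter_partial l g).
Proof.
move=> [sg hg]; split; first exact: smooth_iter_partial.
by move=> l' k; rewrite /iter_partial -foldr_cat; exact: hg.
Qed.

Lemma rschwartz_rapid g : rschwartz g -> rapid g.
Proof.
move=> [sg hg]; split; last exact: (hg [::]).
by apply: continuous_measurable_rV_R; exact: smooth_continuous.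
Qed.

Lemma rapid_mul_coord i P : rapid P -> rapid (fun y => y ord0 i * P y).
Proof.
move=> rP; apply: (@rapid_le _ _ _ P 1 1%N rP).
  by apply: measurable_funM; [exact: measurable_coord|case: rP].
move=> y; rewrite normrM mul1r expr1 ler_wpM2r// (le_trans (coord_le_norm y i))//.
by rewrite lerDr.
Qed.

Lemma rapid_abs P : rapid P -> rapid (fun y => `|P y|).
Proof.
move=> rP; apply: (@rapid_le _ _ _ P 1 0%N rP).
  by apply: measurableT_comp => //; case: rP.
by move=> y; rewrite normr_id mul1r expr0 mul1r.
Qed.

(* With phases, c = 0 gives the real part and c = - pi / 2 the imaginary part
   of the integral of exp(i x.y) P(y), and derivatives keep the same shape. *)
Definition osc P c : V -> R :=
  fun x => \int[lebesgue_rV R d]_y (cos (dotp x y + c) * P y).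

Lemma dotpC (x y : V) : dotp x y = dotp y x.
Proof. by apply: eq_bigr => i _; rewrite mulrC. Qed.

Lemma cos_rapid_rintegrable P c x : rapid P ->
  rintegrable (lebesgue_rV R d) (fun y => cos (dotp x y + c) * P y).
Proof.
move=> rP; apply: (rintegrable_le (g := fun y => `|P y|)).
- apply: measurable_funM; last by case: rP.
  by under eq_fun do rewrite dotpC; exact: measurable_cos_dotp.
- by move=> y; rewrite normrM ler_piMl// cos_max.
- exact/rintegrable_abs/rapid_rintegrable0.
Qed.

Lemma has_grad_osc P c : rapid P ->
  has_grad (osc P c) (fun i => osc (fun y => y ord0 i * P y) (c + pi / 2)).
Proof.
move=> rP.
apply: (@has_grad_integral _ _ _ _ _ (fun x y => cos (dotp x y + c) * P y)
  (fun i x y => cos (dotp x y + (c + pi / 2)) * (y ord0 i * P y))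
  (* This bounds the second-order Taylor remainder in x of cos (x.y + c): one factor [d] from
     [taylor2_rV], one from the Lipschitz constant of the gradient. *)
  (fun y => (d%:R * d%:R) * ((1 + `|y|) ^+ 2 * `|P y|))).
- by move=> x; exact: cos_rapid_rintegrable.
- by move=> i x; apply: cos_rapid_rintegrable; exact: rapid_mul_coord.
- by apply/rintegrableZ/rapid_rintegrable/rapid_abs.
- move=> x v y.
  have -> : cos (dotp (v + x) y + c) * P y - cos (dotp x y + c) * P y -
      lin_rV (fun i => cos (dotp x y + (c + pi / 2)) * (y ord0 i * P y)) v =
    (cos (dotp (v + x) y + c) - cos (dotp x y + c) -
      lin_rV (fun i => cos (dotp x y + (c + pi / 2)) * y ord0 i) v) * P y.
    rewrite !mulrBl; congr (_ - _); rewrite /lin_rV mulr_suml.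
    by apply: eq_bigr => i _; rewrite !mulrA.
  have Lip i x' v' : `|cos (dotp (x' + v') y + (c + pi / 2)) * y ord0 i -
      cos (dotp x' y + (c + pi / 2)) * y ord0 i| <= d%:R * `|y| ^+ 2 * `|v'|.
    apply: (lipschitz_rV (has_gradM (has_grad_cos_dotp y (c + pi / 2)) (has_grad_cst (y ord0
      i)))).
    move=> j z /=; rewrite mulr0 addr0 -mulrA normrM -[leRHS]mul1r ler_pM ?cos_max//.
    by rewrite normrM expr2 ler_pM// coord_le_norm.
  have := taylor2_rV (has_grad_cos_dotp y c) Lip x v.
  rewrite normrM => /(ler_wpM2r (normr_ge0 (P y)))/le_trans; apply.
  rewrite [leLHS](_ : _ = d%:R * d%:R * (`|y| ^+ 2 * (`|P y| * `|v| ^+ 2))); last by ring.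
  rewrite [leRHS](_ : _ = d%:R * d%:R * ((1 + `|y|) ^+ 2 * (`|P y| * `|v| ^+ 2))); last by ring.
  rewrite ler_wpM2l ?mulr_ge0// ler_wpM2r ?mulr_ge0 ?sqr_ge0//.
  by rewrite lerXn2r ?nnegrE ?addr_ge0// lerDr.
Qed.

Lemma osc_bounded P c : rapid P -> exists M, forall x, `|osc P c x| <= M.
Proof.
move=> rP; exists (\int[lebesgue_rV R d]_y `|P y|) => x.
apply: Rintegral_abs_le.
- exact: cos_rapid_rintegrable.
- exact/rintegrable_abs/rapid_rintegrable0.
- by move=> y; rewrite normrM ler_piMl// cos_max.
Qed.

Lemma gaussVE b : gaussV b = fun x : V => expR (- (b * dotp x x)).
Proof.
apply/funext => x; rewrite /gaussV /gaussb -expR_sum; congr expR.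
by rewrite /dotp sumrN mulr_sumr; congr (- _); apply: eq_bigr => i _; rewrite expr2.
Qed.

Lemma has_grad_gaussV b :
  has_grad (@gaussV R d b) (fun i x => (- (2 * b)) * x ord0 i * gaussV b x).
Proof.
have h : has_grad (fun x : V => - (b * dotp x x)) (fun i x => (- (2 * b)) * x ord0 i).
  apply: (@has_grad_quadratic _ _ _ _ (cst (`|b| * d%:R))) => x v.
  have -> : - (b * dotp (v + x) (v + x)) - - (b * dotp x x) -
      lin_rV (fun i => (- (2 * b)) * x ord0 i) v = - (b * dotp v v).
    rewrite /dotp /lin_rV !mulr_sumr -!sumrN -!big_split/=.
    by apply: eq_bigr => i _; rewrite !mxE; ring.
  rewrite normrN normrM -mulrA ler_wpM2l// ger0_norm ?dotp_sqr_le//.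
  by apply: sumr_ge0 => i _; rewrite -expr2 sqr_ge0.
have := has_grad_comp h (fun t => is_derive_expR t).
rewrite gaussVE; apply: has_grad_ext => i x /=.
by rewrite mulrC.
Qed.

(** All derivatives lie in the span of functions Gaussian times [osc], since differentiation only
    brings down a coordinate x_i or moves a coordinate y_i into the density. [osc] is merely
    bounded, so the decay comes from the Gaussian. *)
Lemma rschwartz_gauss_osc b P c : 0 < b -> rapid P ->
  rschwartz (fun x => gaussV b x * osc P c x).
Proof.
move=> b0 rP.
pose A (a : V -> R) := (exists r i, a = fun x => r * x ord0 i) \/ exists r, a = cst r.
pose M (m : V -> R) := exists P c, rapid P /\ m = fun x => gaussV b x * osc P c x.
have AP a : A a -> exists2 da, has_grad a da & forall i, A (da i).
  case=> [[r [i ->]]|[r ->]]; last first.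
    by exists (fun _ => cst 0); [exact: has_grad_cst|move=> i; right; exists 0].
  exists (fun j => cst (r * (j == i)%:R)); last by move=> j; right; exists (r * (j == i)%:R).
  have := has_gradM (has_grad_cst r) (has_grad_coord i).
  by apply: has_grad_ext => j x /=; rewrite mul0r add0r.
have MP m : M m -> exists2 dm, has_grad m dm & forall i, span A M (dm i).
  move=> [Q [c' [rQ ->]]]; have := has_gradM (has_grad_gaussV b) (has_grad_osc c' rQ).
  move=> H; eexists; first exact: H.
  move=> i; apply: span_add; last first.
    apply: span_gen; exists (fun y : V => y ord0 i * Q y), (c' + pi / 2); split=> //.
    exact: rapid_mul_coord.
  rewrite (_ : (fun x => _) = (fun x : V => (- (2 * b)) * x ord0 i) \* (fun x => gaussV b x *
    osc Q c' x)).
    apply: span_mul; first by left; exists (- (2 * b)), i.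
    by apply: span_gen; exists Q, c'.
  by apply/funext => x; rewrite /= mulrA.
(* Every member of the class is at most a power of 1 + |x| times the Gaussian; as the class contains
   all derivatives, this bounds them all. *)
have bnd h : span A M h -> exists C k, forall x, `|h x| <= C * (1 + `|x|) ^+ k * gaussV b x.
  elim=> {h}[m [Q [c' [rQ ->]]]|h g _ [C1 [k1 H1]] _ [C2 [k2 H2]]|a h Aa _ [C [k H]]].
  - have [C HC] := osc_bounded c' rQ; exists C, 0%N => x.
    rewrite expr0 mulr1 normrM ger0_norm ?gaussV_ge0// mulrC.
    by rewrite ler_wpM2r ?gaussV_ge0.
  - exists (`|C1| + `|C2|), (k1 + k2)%N => x; rewrite (le_trans (ler_normD _ _))//.
    have K (B : R) k k' : (k <= k')%N ->
        B * (1 + `|x|) ^+ k * gaussV b x <= `|B| * (1 + `|x|) ^+ k' * gaussV b x.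
      move=> kk'; rewrite ler_wpM2r ?gaussV_ge0//.
      apply: (@le_trans _ _ (`|B| * (1 + `|x|) ^+ k)).
        by rewrite ler_wpM2r ?exprn_ge0 ?addr_ge0// ler_norm.
      by rewrite ler_wpM2l// ler_weXn2l// lerDl.
    by rewrite 2!mulrDl; apply: lerD; [apply: le_trans (H1 x) _|apply: le_trans (H2 x) _];
      apply: K; rewrite ?leq_addr ?leq_addl.
  - have [r Hr] : exists r, forall x, `|a x| <= r * (1 + `|x|).
      case: Aa => [[r [i ->]]|[r ->]]; exists `|r| => x /=.
        by rewrite normrM ler_wpM2l// (le_trans (coord_le_norm x i))// lerDr.
      by rewrite ler_peMr// lerDl.
    exists (r * C), k.+1 => x; rewrite normrM (le_trans (ler_pM _ _ (Hr x) (H x)))//.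
    by rewrite exprS; lra.
have [s Cl] := smooth_coind (span_grad AP MP) (span_gen A (ex_intro _ P (ex_intro _ c (conj rP
  erefl))) : span A M _).
split=> // l k; have [C [m HC]] := bnd _ (Cl l).
have [_ /(_ (k + m)%N)[K hK]] := @gaussV_rapid R d b b0.
exists (`|C| * K) => x; apply: le_trans (ler_wpM2l (normr_ge0 C) (hK x)).
rewrite exprD -mulrA mulrCA ler_wpM2l ?exprn_ge0 ?addr_ge0// (le_trans (HC x))//.
rewrite [`|gaussV _ _|]ger0_norm ?gaussV_ge0// -mulrA.
by rewrite ler_wpM2r ?mulr_ge0 ?gaussV_ge0 ?exprn_ge0 ?addr_ge0// ler_norm.
Qed.

End rschwartz.

(** * Gaussian regularisation as a Fourier transform *)

Section fourier_gauss_osc.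
Context {R : realType} {d : nat}.
Local Notation V := 'rV[R]_d.
Local Notation leb := (lebesgue_rV R d).
Implicit Types (g : V -> R) (x y z xi : V).

Lemma dotpDr x y z : dotp x (y + z) = dotp x y + dotp x z.
Proof. by rewrite /dotp -big_split; apply: eq_bigr => i _; rewrite mxE mulrDr. Qed.

Lemma dotpZl r x y : dotp (r *: x) y = r * dotp x y.
Proof. by rewrite /dotp mulr_sumr; apply: eq_bigr => i _; rewrite mxE mulrA. Qed.

Lemma dotpZr r x y : dotp x (r *: y) = r * dotp x y.
Proof. by rewrite dotpC dotpZl dotpC. Qed.

Lemma dotpNr x y : dotp x (- y) = - dotp x y.
Proof. by rewrite -scaleN1r dotpZr mulN1r. Qed.

Lemma gaussV_scale b r x : gaussV b (r *: x) = gaussV (b * r ^+ 2) x.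
Proof. by apply: eq_bigr => i _; rewrite /gaussb mxE exprMn mulrA. Qed.

Let kappa : R := Num.sqrt pi ^+ d.

Lemma gauss_fourier_scaled (e : R) w c : 0 < e ->
  \int[leb]_x (cos (dotp x w + c) * gaussV (e ^+ 2) x) =
  (e ^- d) * (cos c * (kappa * gaussV (1 / 4) (e^-1 *: w))).
Proof.
move=> e0; have ei : 0 < e^-1 by rewrite invr_gt0.
have E : (fun v => cos (dotp (0 + e^-1 *: v) w + c) * gaussV (e ^+ 2) (0 + e^-1 *: v)) =
    (fun v => cos (dotp v (e^-1 *: w) + c) * gaussV 1 v).
  apply/funext => v; rewrite add0r dotpZl dotpZr gaussV_scale.
  by rewrite exprVn mulfV// expf_neq0// gt_eqF.
have mf : measurable_fun setT (fun x => cos (dotp x w + c) * gaussV (e ^+ 2) x).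
  by apply: measurable_funM; [exact: measurable_cos_dotp|exact: measurable_gaussV].
rewrite (Rintegral_affine (a := 0) ei mf) E; last first.
  have := @cos_rapid_rintegrable R d (gaussV 1) c (e^-1 *: w) (gaussV_rapid ltr01).
  by rewrite (_ : (fun _ => _) = (fun v => cos (dotp v (e^-1 *: w) + c) * gaussV 1 v))//;
    apply/funext => v; rewrite dotpC.
by rewrite gauss_fourier exprVn.
Qed.

(** The convolution of [g] with a Gaussian of width [e], written after the substitution y = x + e z,
    so that derivatives fall on [g]. It is not normalised: its limit is [g] times the Gaussian mass
    [W]. *)
Definition gauss_avg (e : R) g x : R :=
  \int[leb]_z (g (x + e *: z) * gaussV (1 / 4) z).

(** After exchanging the integrals, the one in x is the transform of a Gaussian at xi - y, which
    concentrates near y = xi at scale [e]. *)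
Lemma osc_gauss_fubini (e : R) g xi c : 0 < e -> rapid g ->
  \int[leb]_x (gaussV (e ^+ 2) x * \int[leb]_y (cos (dotp x (xi - y) + c) * g y)) =
  cos c * (kappa * gauss_avg e g xi).
Proof.
move=> e0 rg; have e20 : 0 < e ^+ 2 by rewrite exprn_gt0.
pose f x y := gaussV (e ^+ 2) x * (cos (dotp x (xi - y) + c) * g y).
have mcoord1 i : measurable_fun setT (fun z : V * V => z.1 ord0 i).
  by apply: (measurableT_comp (measurable_coord i)).
have mcoord2 i : measurable_fun setT (fun z : V * V => z.2 ord0 i).
  by apply: (measurableT_comp (measurable_coord i)).
have mf : measurable_fun setT (fun z : V * V => f z.1 z.2).
  apply: measurable_funM.
    by apply: (measurableT_comp (measurable_gaussV _)).
  apply: measurable_funM; last by case: rg => mg _; apply: (measurableT_comp mg).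
  apply: (measurableT_comp (f := cos)).
    by apply: continuous_measurable_fun; exact: continuous_cos.
  apply: measurable_funD => //; apply: measurable_sum => i; apply: measurable_funM => //.
  under eq_fun do rewrite mxE; apply: measurable_funD => //.
  by under eq_fun do rewrite mxE; exact: measurableT_comp.
have ik := rapid_rintegrable0 (@gaussV_rapid R d _ e20).
have ig := rintegrable_abs (rapid_rintegrable0 rg).
have fb x y : `|f x y| <= gaussV (e ^+ 2) x * `|g y|.
  rewrite normrM ger0_norm ?gaussV_ge0// ler_wpM2l ?gaussV_ge0//.
  by rewrite normrM ler_piMl// cos_max.
have E1 x : gaussV (e ^+ 2) x * \int[leb]_y (cos (dotp x (xi - y) + c) * g y) =
    \int[leb]_y f x y.
  rewrite RintegralZl//.
  apply: (rintegrable_le (g := fun y => `|g y|)) => //; last first.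
    by move=> y; rewrite normrM ler_piMl// cos_max.
  apply: measurable_funM; last by case: rg.
  apply: (measurableT_comp (f := cos)).
    by apply: continuous_measurable_fun; exact: continuous_cos.
  apply: measurable_funD => //; apply: measurable_sum => i; apply: measurable_funM => //.
  under eq_fun do rewrite mxE; apply: measurable_funD => //.
  by under eq_fun do rewrite mxE; apply: measurableT_comp => //; exact: measurable_coord.
under eq_Rintegral do rewrite E1.
rewrite (dominated_Fubini mf ik ig fb).
(* The factor e^-d from the Gaussian transform is cancelled by the Jacobian e^d of y = xi + e z. *)
pose C := e ^- d * (cos c * kappa).
have E2 y : \int[leb]_x f x y = C * (g y * gaussV (1 / 4) (e^-1 *: (xi - y))).
  transitivity (\int[leb]_x (g y * (cos (dotp x (xi - y) + c) * gaussV (e ^+ 2) x))).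
    by apply: eq_Rintegral => x _; rewrite /f; ring.
  rewrite RintegralZl//; last first.
    have := @cos_rapid_rintegrable R d (gaussV (e ^+ 2)) c (xi - y) (gaussV_rapid e20).
    by rewrite (_ : (fun _ => _) = (fun v => cos (dotp v (xi - y) + c) * gaussV (e ^+ 2) v))//;
      apply/funext => v; rewrite dotpC.
  by rewrite gauss_fourier_scaled// /C; ring.
under eq_Rintegral do rewrite E2.
have E3 : (fun z => C * (g (xi + e *: z) * gaussV (1 / 4) (e^-1 *: (xi - (xi + e *: z))))) =
    (fun z => C * (g (xi + e *: z) * gaussV (1 / 4) z)).
  apply/funext => z; rewrite opprD addrA subrr sub0r -scalerN scalerA mulVf ?gt_eqF//.
  by rewrite scale1r -scaleN1r gaussV_scale sqrrN expr1n mulr1.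
have mg : measurable_fun setT (fun z => g (xi + e *: z)).
  by apply: measurableT_comp; [case: rg|exact: measurable_affine].
have iavg : rintegrable leb (fun z => g (xi + e *: z) * gaussV (1 / 4) z).
  have [M hM] := rg.2 0%N.
  apply: (rintegrable_le (g := fun z => M * gaussV (1 / 4) z)).
  - by apply: measurable_funM; [exact: mg|exact: measurable_gaussV].
  - move=> z; rewrite normrM [`|gaussV _ _|]ger0_norm ?gaussV_ge0//.
    rewrite ler_wpM2r ?gaussV_ge0//.
    by have := hM (xi + e *: z); rewrite expr0 mul1r.
  - by apply: rintegrableZ; apply/rapid_rintegrable0/gaussV_rapid; lra.
rewrite (Rintegral_affine (a := xi) e0); first last.
- by rewrite E3; exact: rintegrableZ.
- apply: measurable_funM => //; apply: measurable_funM; first by case: rg.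
  apply: (measurableT_comp (measurable_gaussV _)).
  rewrite (_ : (fun y => _) = (fun y => e^-1 *: xi + (- e^-1) *: y));
    first exact: measurable_affine.
  by apply/funext => y; rewrite scalerBr scaleNr.
rewrite E3 RintegralZl// /C /gauss_avg.
by rewrite -!mulrA mulVKf ?expf_neq0 ?gt_eqF.
Qed.

Definition gauss_osc (e : R) g : V -> R[i] := fun x =>
  (gaussV (e ^+ 2) x * osc g 0 x +i* (gaussV (e ^+ 2) x * osc g (- (pi / 2)) x))%C.

(** The addition formula for cos (t - a): multiplication by exp (- i a) is a rotation of the
    phase. *)
Lemma osc_rotate g x a c : rapid g ->
  cos a * osc g c x + sin a * osc g (c - pi / 2) x =
  \int[leb]_y (cos (dotp x y + c - a) * g y).
Proof.
move=> rg; rewrite /osc -!RintegralZl//; [|exact: cos_rapid_rintegrable..].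
rewrite -RintegralD//; [|by apply: rintegrableZ; exact: cos_rapid_rintegrable..].
apply: eq_Rintegral => y _.
rewrite (addrA _ c) -sin_cosB [cos (_ - a)]cosB; ring.
Qed.

Lemma fourier_gauss_osc (e : R) g xi : 0 < e -> rapid g ->
  fourier (gauss_osc e g) xi = (kappa * gauss_avg e g xi)%:C%C.
Proof.
move=> e0 rg; rewrite /fourier /cintegral; congr (_ +i* _)%C.
  rewrite -[RHS]mul1r -cos0 -(osc_gauss_fubini xi 0 e0 rg).
  apply: eq_Rintegral => x _ /=.
  transitivity (gaussV (e ^+ 2) x * (cos (dotp x xi) * osc g 0 x + sin (dotp x xi) * osc g (0 -
    pi / 2) x)).
    by rewrite cosN sinN sub0r; ring.
  rewrite osc_rotate//; congr (_ * _); apply: eq_Rintegral => y _; congr (_ * _).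
  by rewrite dotpDr dotpNr -cosN; congr cos; ring.
(* The imaginary part is the same double integral with phase pi / 2, so the prefactor cos (pi / 2)
   makes it vanish. *)
transitivity (cos (pi / 2) * (kappa * gauss_avg e g xi)); last by rewrite cos_pihalf mul0r.
rewrite -(osc_gauss_fubini xi _ e0 rg); apply: eq_Rintegral => x _ /=.
transitivity (gaussV (e ^+ 2) x * (cos (dotp x xi + pi / 2) * osc g 0 x +
    sin (dotp x xi + pi / 2) * osc g (0 - pi / 2) x)).
  rewrite cosD sinD cos_pihalf sin_pihalf cosN sinN sub0r; ring.
rewrite osc_rotate//; congr (_ * _); apply: eq_Rintegral => y _; congr (_ * _).
by rewrite dotpDr dotpNr -cosN; congr cos; ring.
Qed.

Lemma schwartz_gauss_osc (e : R) g : 0 < e -> rapid g -> schwartz (gauss_osc e g).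
Proof.
by move=> e0 rg; apply/schwartzE; split; apply: rschwartz_gauss_osc; rewrite ?exprn_gt0.
Qed.

Lemma gauss_avg_rintegrable (e : R) g x b : rapid g -> 0 < b ->
  rintegrable leb (fun z => g (x + e *: z) * gaussV b z).
Proof.
move=> rg b0; have [M hM] := rg.2 0%N.
apply: (rintegrable_le (g := fun z => M * gaussV b z)).
- apply: measurable_funM; last exact: measurable_gaussV.
  by apply: measurableT_comp; [case: rg|exact: measurable_affine].
- move=> z; rewrite normrM [`|gaussV _ _|]ger0_norm ?gaussV_ge0//.
  rewrite ler_wpM2r ?gaussV_ge0//.
  by have := hM (x + e *: z); rewrite expr0 mul1r.
- by apply: rintegrableZ; exact/rapid_rintegrable0/gaussV_rapid.
Qed.

Lemma finite_bound (I : finType) (T : Type) (f : I -> T -> R) :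
  (forall i, exists M, forall t, f i t <= M) ->
  exists2 M, 0 <= M & forall i t, f i t <= M.
Proof.
move=> /choice[M hM]; exists (\sum_i `|M i|); first exact: sumr_ge0.
move=> i t; rewrite (le_trans (hM i t))// (bigD1 i)//= (le_trans (ler_norm _))//.
by rewrite lerDl sumr_ge0.
Qed.

Lemma has_grad_gauss_avg (e : R) g : rschwartz g ->
  has_grad (gauss_avg e g) (fun i => gauss_avg e (partial i g)).
Proof.
move=> sg; have rg := rschwartz_rapid sg.
have sgi i : rschwartz (partial i g) := rschwartz_iter_partial [:: i] sg.
have g4 : 0 < 1 / 4 :> R by lra.
have [B B0 hB] : exists2 B, 0 <= B &
    forall (ij : 'I_d * 'I_d) x, `|partial ij.1 (partial ij.2 g) x| <= B.
  apply: finite_bound => -[i j]; have [M hM] := sg.2 [:: i; j] 0%N.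
  by exists M => x; have := hM x; rewrite expr0 mul1r.
apply: (@has_grad_integral _ _ _ _ leb (fun x z => g (x + e *: z) * gaussV (1 / 4) z)
  (fun i x z => partial i g (x + e *: z) * gaussV (1 / 4) z)
  (fun z => d%:R * (d%:R * B) * gaussV (1 / 4) z)).
- by move=> x; exact: gauss_avg_rintegrable.
- by move=> i x; apply: gauss_avg_rintegrable => //; exact: rschwartz_rapid.
- by apply: rintegrableZ; exact/rapid_rintegrable0/gaussV_rapid.
move=> x v z; have Lip i x' v' : `|partial i g (x' + v') - partial i g x'| <= d%:R * B * `|v'|.
  apply: (lipschitz_rV (smooth_has_grad (sgi i).1)) => j y.
  exact: (hB (j, i)).
have := taylor2_rV (smooth_has_grad sg.1) Lip (x + e *: z) v.
move=> /(ler_wpM2r (gaussV_ge0 (1 / 4) z)).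
rewrite -[X in _ * X <= _](ger0_norm (gaussV_ge0 (1 / 4) z)) -normrM addrA.
rewrite [leRHS]mulrAC; congr (`|_| <= _).
rewrite !mulrBl; congr (_ - _); rewrite /lin_rV mulr_suml.
by apply: eq_bigr => i _; rewrite !mulrA.
Qed.

Lemma iter_partial_gauss_avg (e : R) l g : rschwartz g ->
  iter_partial l (gauss_avg e g) = gauss_avg e (iter_partial l g).
Proof.
move=> sg; elim: l => //= i l ->.
exact: (has_grad_partial i (has_grad_gauss_avg e (rschwartz_iter_partial l sg))).
Qed.

Lemma smooth_gauss_avg (e : R) g : rschwartz g -> smooth (gauss_avg e g).
Proof.
move=> sg l x; rewrite iter_partial_gauss_avg//.
by have [] := has_grad_gauss_avg e (rschwartz_iter_partial l sg) x.
Qed.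

Let W := \int[leb]_z (gaussV (1 / 4) z).

(** The difference averages g (x + e z) - g x, which the mean value theorem bounds by e |z| times
    the gradient at an intermediate point. Only bounds on first partials enter, so the estimate
    applies again to each derivative of [g]. *)
Lemma gauss_avg_dist g k : rschwartz g -> exists2 C, 0 <= C & forall e x, 0 < e <= 1 ->
  (1 + `|x|) ^+ k * `|gauss_avg e g x - W * g x| <= e * C.
Proof.
move=> sg; have rg := rschwartz_rapid sg.
have g4 : 0 < 1 / 4 :> R by lra.
have rG := @gaussV_rapid R d _ g4.
have [B B0 hB] : exists2 B, 0 <= B &
    forall (i : 'I_d) x, (1 + `|x|) ^+ k * `|partial i g x| <= B.
  by apply: finite_bound => i; exact: (sg.2 [:: i] k).
(* Of the k + 1 powers, k pay for moving the weight from x to the intermediate point and one bounds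
   the increment e z. *)
pose Q z := (1 + `|z|) ^+ k.+1 * gaussV (1 / 4) z.
have iQ : rintegrable leb Q by exact: rapid_rintegrable.
exists (d%:R * B * \int[leb]_z Q z).
  by rewrite mulr_ge0 ?mulr_ge0// Rintegral_ge0// => z _;
    rewrite mulr_ge0 ?exprn_ge0 ?addr_ge0 ?gaussV_ge0.
move=> e x /andP[e0 e1]; have ia := @gauss_avg_rintegrable e g x _ rg g4.
have iG := rapid_rintegrable0 rG.
have xk : 0 < (1 + `|x|) ^+ k by rewrite exprn_gt0// ltr_wpDr.
have E : gauss_avg e g x - W * g x =
    \int[leb]_z ((g (x + e *: z) - g x) * gaussV (1 / 4) z).
  rewrite mulrC /W -RintegralZl// -RintegralB//; last exact: rintegrableZ.
  by apply: eq_Rintegral => z _; rewrite mulrBl.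
pose D := e * (d%:R * B * (1 + `|x|) ^- k).
have le z : `|(g (x + e *: z) - g x) * gaussV (1 / 4) z| <= D * Q z.
  rewrite normrM [`|gaussV _ _|]ger0_norm ?gaussV_ge0// /Q mulrA.
  rewrite ler_wpM2r ?gaussV_ge0//.
  have [t /andP[t0 t1] ->] := MVT_rV x (e *: z) (smooth_has_grad sg.1).
  set y := x + t *: (e *: z).
  (* Peetre-type inequality: 1 + |x| <= (1 + |y|) (1 + |z|), because y differs from x by at most |z|
     when [e] and [t] are at most 1. *)
  have xyz : (1 + `|x|) ^+ k <= (1 + `|y|) ^+ k * (1 + `|z|) ^+ k.
    rewrite -exprMn lerXn2r ?nnegrE ?mulr_ge0 ?addr_ge0//.
    have : `|x| <= `|y| + `|z|.
      rewrite -[x in leLHS](addrK (t *: (e *: z))) -/y (le_trans (ler_normB _ _))//.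
      rewrite lerD2l scalerA normrZ ler_piMl// ger0_norm ?mulr_ge0 ?(ltW e0)//.
      exact: (mulr_ile1 t0 (ltW e0) t1 e1).
    have := normr_ge0 y; have := normr_ge0 z; nra.
  apply: le_trans (lin_rV_le _ (B := B * (1 + `|z|) ^+ k * (1 + `|x|) ^- k) _) _.
    move=> i; rewrite ler_pdivlMr// mulrC.
    apply: (@le_trans _ _ ((1 + `|y|) ^+ k * (1 + `|z|) ^+ k * `|partial i g y|)).
      by rewrite ler_wpM2r.
    by rewrite mulrAC ler_wpM2r ?exprn_ge0 ?addr_ge0// hB.
  rewrite normrZ (ger0_norm (ltW e0)) exprS /D.
  rewrite [leRHS](_ : _ = d%:R * (B * (1 + `|z|) ^+ k * (1 + `|x|) ^- k) * (e * (1 + `|z|)));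
    last by ring.
  rewrite ler_wpM2l ?mulr_ge0 ?invr_ge0 ?exprn_ge0 ?addr_ge0//.
  by rewrite ler_wpM2l ?lerDr ?ltW.
have iD : rintegrable leb (fun z => (g (x + e *: z) - g x) * gaussV (1 / 4) z).
  have := rintegrableB ia (rintegrableZ (g x) iG).
  by under [X in rintegrable _ X -> _]eq_fun do rewrite -mulrBl.
rewrite E (le_trans (ler_wpM2l (ltW xk) (Rintegral_abs_le iD (rintegrableZ D iQ) le)))//.
rewrite RintegralZl// /D.
rewrite [leLHS](_ : _ = e * (d%:R * B * \int[leb]_z Q z) * ((1 + `|x|) ^+ k / (1 + `|x|) ^+ k)).
  by rewrite mulfV ?gt_eqF// mulr1.
by ring.
Qed.

(** Comparison with exp (- t^2) <= exp (- t^2 / 4), whose integral is the square root of pi. *)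
Lemma gauss_mass_gt0 : 0 < W.
Proof.
rewrite /W (integral_prod_coord _ (@gaussb_ge0 R _) (gaussb_rintegrable _)).2; last lra.
apply: exprn_gt0; apply: (@lt_le_trans _ _ (\int[lebesgue_measure]_t (gaussb 1 t))).
  rewrite /Rintegral (_ : (fun t => _) = fun t => (gauss_fun t)%:E) ?integralT_gauss.
    by rewrite /= sqrtr_gt0 pi_gt0.
  by apply/funext => t; rewrite /gaussb mul1r.
apply: le_Rintegral => //; [exact: gaussb_rintegrable|apply: gaussb_rintegrable; lra|].
by move=> t _; rewrite ler_expR; have := sqr_ge0 t; lra.
Qed.

End fourier_gauss_osc.

(** * Tempered functionals determined by their values on Fourier transforms *)

Section density.
Context {R : realType} {d : nat}.
Local Notation V := 'rV[R]_d.
Local Notation leb := (lebesgue_rV R d).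
Implicit Types (g h : V -> R) (x y z xi : V).

Lemma has_grad_lin g h k : smooth g -> smooth h ->
  has_grad (fun x => g x + k * h x) (fun i x => partial i g x + k * partial i h x).
Proof.
move=> sg sh.
have := has_gradD (smooth_has_grad sg) (has_gradM (has_grad_cst k) (smooth_has_grad sh)).
by apply: has_grad_ext => i x /=; rewrite mul0r add0r.
Qed.

Lemma iter_partial_lin g h k l : smooth g -> smooth h ->
  iter_partial l (fun x => g x + k * h x) =
  (fun x => iter_partial l g x + k * iter_partial l h x).
Proof.
move=> sg sh; elim: l => //= i l ->.
by rewrite (has_grad_partial i (has_grad_lin k (smooth_iter_partial l sg) (smooth_iter_partial
  l sh))).
Qed.

Lemma rschwartz_lin g h k : rschwartz g -> rschwartz h ->
  rschwartz (fun x => g x + k * h x).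
Proof.
move=> [sg hg] [sh hh]; split.
  move=> l x; rewrite iter_partial_lin//.
  by have [] := has_grad_lin k (smooth_iter_partial l sg) (smooth_iter_partial l sh) x.
move=> l m; have [M hM] := hg l m; have [N hN] := hh l m; exists (M + `|k| * N) => x.
rewrite iter_partial_lin//.
apply: (le_trans (ler_wpM2l _ (ler_normD _ _))); first by rewrite exprn_ge0 ?addr_ge0.
rewrite mulrDr lerD//; rewrite normrM mulrCA ler_wpM2l//.
Qed.

(** Decay is inherited from [W * g], from which the average differs by a bounded amount in every
    weighted norm. *)
Lemma rschwartz_gauss_avg e g : 0 < e <= 1 -> rschwartz g -> rschwartz (gauss_avg e g).
Proof.
move=> e01 sg; split; first exact: smooth_gauss_avg.
move=> l k; rewrite iter_partial_gauss_avg//.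
have [C C0 hC] := gauss_avg_dist k (rschwartz_iter_partial l sg).
have [M hM] := sg.2 l k.
set W := \int[leb]_z gaussV (1 / 4) z.
exists (e * C + `|W| * M) => x; have := hC e x e01.
set a := gauss_avg _ _ _; set b := iter_partial l g x => H.
have -> : a = (a - W * b) + W * b by rewrite subrK.
apply: (le_trans (ler_wpM2l _ (ler_normD _ _))); first by rewrite exprn_ge0 ?addr_ge0.
by rewrite mulrDr lerD// normrM mulrCA ler_wpM2l// hM.
Qed.

(** Only finitely many derivatives have order at most [N]; summing the constants over all tuples of
    length at most [N] dominates each of them. *)
Lemma seq_bound (N : nat) (P : seq 'I_d -> R -> Prop) :
  (forall l, exists2 C, 0 <= C & P l C) ->
  (forall l C C', C <= C' -> P l C -> P l C') ->
  exists2 C, 0 <= C & forall l, (size l <= N)%N -> P l C.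
Proof.
move=> H mono; have /choice[C hC] : forall l, exists C, 0 <= C /\ P l C.
  by move=> l; have [C C0 PC] := H l; exists C.
have C0 l : 0 <= C l by case: (hC l).
exists (\sum_(m < N.+1) \sum_(t : m.-tuple 'I_d) C t).
  by apply: sumr_ge0 => m _; apply: sumr_ge0.
move=> l lN; apply: (mono _ _ _ _ (hC l).2).
rewrite (bigD1 (Ordinal (lN : (size l < N.+1)%N)))//= (bigD1 (in_tuple l))//= -addrA lerDl.
by rewrite addr_ge0 ?sumr_ge0// => m _; rewrite sumr_ge0.
Qed.

Definition toC h : V -> R[i] := fun x => (h x)%:C%C.

Lemma schwartz_toC h : rschwartz h -> schwartz (toC h).
Proof. by move=> sh; apply/schwartzE; split=> //; exact: rschwartz0. Qed.

Let W := \int[leb]_z gaussV (1 / 4) z.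

Lemma schwartz_norm_gauss_avg g N : rschwartz g ->
  exists2 C, 0 <= C & forall e, 0 < e <= 1 ->
    schwartz_norm_le N (e * C) (toC (fun x => gauss_avg e g x + (- W) * g x)).
Proof.
move=> sg.
pose P l C := forall e x, 0 < e <= 1 -> (1 + `|x|) ^+ N *
  `|gauss_avg e (iter_partial l g) x - W * iter_partial l g x| <= e * C.
have mono l C C' : C <= C' -> P l C -> P l C'.
  move=> CC' H e x e01; rewrite (le_trans (H e x e01))// ler_wpM2l//.
  by case/andP : e01 => /ltW.
have [C C0 hC] := seq_bound N (fun l => gauss_avg_dist N (rschwartz_iter_partial l sg)) mono.
(* The power of [d.+1] converts the Euclidean weight of [schwartz_norm_le] into the sup-norm
   weight. *)
exists (d.+1%:R ^+ N * C); first by rewrite mulr_ge0 ?exprn_ge0.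
move=> e e01 l x lN; have [e0 _] := andP e01.
split; last first.
  rewrite (_ : im_part _ = fun=> 0)// smooth_cst0.2 normr0 mulr0.
  by rewrite !mulr_ge0 ?exprn_ge0// ltW.
rewrite (_ : re_part _ = (fun x => gauss_avg e g x + (- W) * g x))//.
rewrite iter_partial_lin; [|exact: smooth_gauss_avg|by case: sg].
rewrite iter_partial_gauss_avg// mulNr mulrCA.
apply: le_trans (ler_wpM2l _ (hC l lN e x e01)); last by rewrite exprn_ge0.
rewrite mulrA -exprMn ler_wpM2r// lerXn2r ?nnegrE ?addr_ge0 ?enorm_ge0 ?mulr_ge0 ?addr_ge0//.
exact: one_enorm_le.
Qed.

Lemma complex_small_eq0 (z : R[i]) (K : R) :
  (forall e, 0 < e <= 1 -> `|z| <= ((e * K)%:C)%C) -> z = 0.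
Proof.
move=> H; apply/eqP; rewrite -normr_eq0 normc_def.
set s := Num.sqrt _; suff -> : s = 0 by [].
have s0 : 0 <= s by exact: sqrtr_ge0.
apply/eqP; rewrite eq_le s0 andbT leNgt; apply/negP => sp.
have K0 : 0 < `|K| + s by rewrite ltr_wpDl.
(* With s = |z| > 0 this [e] is at most 1 and e K <= s |K| / (2 (|K| + s)) < s, a contradiction. *)
pose e := s / (2 * (`|K| + s)).
have /H : 0 < e <= 1.
  rewrite divr_gt0 ?mulr_gt0//= ler_pdivrMr ?mulr_gt0// mul1r.
  have := normr_ge0 K; lra.
rewrite normc_def lecR -/s leNgt => /negP; apply.
rewrite /e mulrAC ltr_pdivrMr ?mulr_gt0// ltr_pM2l//.
have := ler_norm K; have := normr_ge0 K; lra.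
Qed.

Variable mu : {finite_measure set V -> \bar R}.
Variable T : functional R d.
Hypothesis tT : tempered T.

Let I := functional_of_measure mu.

Lemma rschwartz_rintegrable g : rschwartz g -> rintegrable mu g.
Proof.
move=> sg; have [M hM] := sg.2 [::] 0%N.
apply: (rintegrable_le (g := cst M)).
- by case: (rschwartz_rapid sg).
- by move=> x; have := hM x; rewrite expr0 mul1r.
- exact: finite_measure_integrable_cst.
Qed.

Lemma functional_of_measure_toC g : I (toC g) = (\int[mu]_x g x)%:C%C.
Proof. by rewrite /I /functional_of_measure /cintegral/= {2}/Rintegral integral0. Qed.

Lemma tempered0 : T (toC (fun=> 0)) = 0.
Proof.
have [lin _] := tT.
have s0 : schwartz (toC (fun=> 0)) := schwartz_toC rschwartz0.
have := lin 1 _ _ s0 s0; rewrite (_ : (fun _ => _) = toC (fun=> 0)); last first.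
  by apply/funext => x; rewrite /toC mul1r addr0.
by rewrite mul1r => /eqP; rewrite -subr_eq subrr eq_sym => /eqP.
Qed.

(** Agreement is asked where the transform is itself Schwartz. For [gauss_osc] this is read off from
    its transform, a multiple of [gauss_avg], and invariance of the Schwartz space under [fourier]
    is never invoked. *)
Hypothesis T_fourier : forall f, schwartz f -> schwartz (fourier f) ->
  T (fourier f) = I (fourier f).

Let kappa : R := Num.sqrt pi ^+ d.

Lemma tempered_gauss_avg e g : 0 < e <= 1 -> rschwartz g ->
  T (toC (gauss_avg e g)) = I (toC (gauss_avg e g)).
Proof.
move=> e01 sg; have [e0 _] := andP e01; have rg := rschwartz_rapid sg.
have sa := rschwartz_gauss_avg e01 sg.
have k0 : kappa%:C%C != 0.
  by rewrite -[0]/(0%:C%C) (inj_eq (@complexI _)) expf_neq0// gt_eqF// sqrtr_gt0 pi_gt0.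
have E : fourier (gauss_osc e g) = toC (fun x => kappa * gauss_avg e g x).
  by apply/funext => xi; rewrite fourier_gauss_osc.
(* Linearity in [tempered] has the single form c f + g, so a scalar multiple is written with a zero
   summand. *)
have E' : fourier (gauss_osc e g) =
    (fun x => kappa%:C%C * toC (gauss_avg e g) x + toC (fun=> 0) x).
  by rewrite E; apply/funext => x; rewrite /toC addr0 -rmorphM.
have := T_fourier (schwartz_gauss_osc e0 rg).
rewrite {1}E => /(_ _)H; apply: (mulfI k0).
have [lin _] := tT.
rewrite -[LHS]addr0 -[in LHS]tempered0.
rewrite -lin; [|exact: schwartz_toC|by apply: schwartz_toC; exact: rschwartz0].
rewrite -E' H.
  rewrite E !functional_of_measure_toC -rmorphM; congr (_%:C)%C.
  by rewrite RintegralZl//; exact: rschwartz_rintegrable.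
apply: schwartz_toC; have := rschwartz_lin kappa rschwartz0 sa.
by under eq_fun do rewrite add0r.
Qed.

Lemma tempered_toC g : rschwartz g -> T (toC g) = I (toC g).
Proof.
move=> sg; have [lin [N [A TA]]] := tT.
have [C C0 hC] := schwartz_norm_gauss_avg N sg.
have [C' C'0 hC'] := gauss_avg_dist 0 sg.
apply/eqP; rewrite -subr_eq0; apply/eqP.
have W0 : W%:C%C != 0 by rewrite -[0]/(0%:C%C) (inj_eq (@complexI _)) gt_eqF// gauss_mass_gt0.
apply: (mulfI W0); rewrite mulr0.
(* With D = gauss_avg e g - W g, the quantity W (T g - I g) equals I D - T D. The first summand of
   the constant bounds I D by the sup norm and the total mass, the second bounds T D by
   continuity. *)
apply: (@complex_small_eq0 _ (C' * fine (mu setT) + A * C)) => e e01.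
have sa := rschwartz_gauss_avg e01 sg.
pose D x := gauss_avg e g x + (- W) * g x.
have sD : rschwartz D by exact: rschwartz_lin.
have E : toC (gauss_avg e g) = (fun x => W%:C%C * toC g x + toC D x).
  apply/funext => x; rewrite /toC /D -rmorphM -rmorphD; congr (_%:C)%C; ring.
have := tempered_gauss_avg e01 sg.
rewrite {1}E lin ?functional_of_measure_toC; [|exact: schwartz_toC..].
have -> : \int[mu]_x gauss_avg e g x = W * \int[mu]_x g x + \int[mu]_x D x.
  rewrite -RintegralZl//; last exact: rschwartz_rintegrable.
  rewrite -RintegralD//; first by apply: eq_Rintegral => x _; rewrite /D; ring.
  - by apply: rintegrableZ; exact: rschwartz_rintegrable.
  - exact: rschwartz_rintegrable.
rewrite rmorphD rmorphM => H.
have -> : W%:C%C * (T (toC g) - (\int[mu]_x g x)%:C%C) = (\int[mu]_x D x)%:C%C - T (toC D).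
  by rewrite mulrBr -[W%:C%C * T _](addrK (T (toC D))) H; ring.
apply: le_trans (ler_normB _ _) _; rewrite mulrDr rmorphD; apply: lerD.
  rewrite normc_def/= expr0n addr0 sqrtr_sqr lecR.
  have [e0 _] := andP e01.
  have iC : rintegrable mu (cst (e * C')) by exact: finite_measure_integrable_cst.
  apply: le_trans (Rintegral_abs_le (rschwartz_rintegrable sD) iC _) _.
    by move=> x; have := hC' e x e01; rewrite expr0 mul1r /D mulNr.
  by rewrite Rintegral_cst// mulrA.
by rewrite mulrCA; apply: TA; [exact: schwartz_toC|exact: hC].
Qed.

Lemma tempered_eq_measure : eq_on_schwartz T I.
Proof.
move=> f /schwartzE[s1 s2]; have [lin _] := tT.
have E : f = fun x => 'i%C * toC (im_part f) x + toC (re_part f) x.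
  by apply/funext => x; rewrite /toC /im_part /re_part addrC [LHS]complexE.
rewrite [in LHS]E lin; [|exact: schwartz_toC..].
rewrite !tempered_toC// !functional_of_measure_toC /I /functional_of_measure /cintegral.
by rewrite [RHS]complexE addrC.
Qed.

End density.

(** * Identification of [L_r] on a potential of order [r] *)

Section L_of_potential.
Context {R : realType} {d : nat}.
Local Notation V := 'rV[R]_d.
Local Notation leb := (lebesgue_rV R d).
Variable mu : {finite_measure set V -> \bar R}.

(** Fubini with domination |h xi| * 1, as [mu] is finite. The phases 0 and - pi / 2 give cosine and
    sine; the integrability statements allow the four real pieces of a complex product to be
    recombined. *)
Lemma fourier_measure_swap (c : R) (h : V -> R) : rapid h ->
  [/\ \int[leb]_xi (\int[mu]_x cos (- dotp x xi + c) * h xi) =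
       \int[mu]_x (\int[leb]_xi (cos (- dotp xi x + c) * h xi)),
     rintegrable leb (fun xi => \int[mu]_x cos (- dotp x xi + c) * h xi) &
     rintegrable mu (fun x => \int[leb]_xi (cos (- dotp xi x + c) * h xi))].
Proof.
move=> rh.
have m1 : measurable_fun setT (fun z : V * V => cos (- dotp z.2 z.1 + c)).
  apply: (measurableT_comp (f := cos)).
    by apply: continuous_measurable_fun; exact: continuous_cos.
  apply: measurable_funD => //; apply: measurableT_comp => //.
  apply: measurable_sum => i; apply: measurable_funM.
    exact: (measurableT_comp (measurable_coord i)).
  exact: (measurableT_comp (measurable_coord i)).
have mf : measurable_fun setT (fun z : V * V => cos (- dotp z.2 z.1 + c) * h z.1).
  by apply: measurable_funM => //; case: rh => mh _; apply: (measurableT_comp mh).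
have i1 : rintegrable mu (cst 1) by exact: finite_measure_integrable_cst.
have ih := rintegrable_abs (rapid_rintegrable0 rh).
have fb x y : `|cos (- dotp y x + c) * h x| <= `|h x| * cst 1 y.
  by rewrite normrM mulr1 ler_piMl// cos_max.
have ic xi : rintegrable mu (fun x => cos (- dotp x xi + c)).
  apply: (rintegrable_le (g := cst 1)) => //; last by move=> x; exact: cos_max.
  exact: (measurableT_comp m1 (measurable_pair1 xi)).
have E xi : \int[mu]_x cos (- dotp x xi + c) * h xi = \int[mu]_x (cos (- dotp x xi + c) * h xi).
  by rewrite RintegralZr//; exact: ic.
have E2 x : \int[leb]_xi (cos (- dotp xi x + c) * h xi) =
  \int[leb]_xi (cos (- dotp x xi + c) * h xi).
  by apply: eq_Rintegral => xi _; rewrite dotpC.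
under eq_Rintegral do rewrite E.
under [X in _ = X]eq_Rintegral do rewrite E2.
under [X in rintegrable leb X]eq_fun do rewrite E.
under [X in rintegrable mu X]eq_fun do rewrite E2.
split.
- exact: (dominated_Fubini (m1 := leb) (m2 := mu) mf ih i1 fb).
- exact: (dominated_rintegrable_inner1 (m1 := leb) (m2 := mu) mf ih i1 fb).
- exact: (dominated_rintegrable_inner2 (m1 := leb) (m2 := mu) mf ih i1 fb).
Qed.

(** The multiplication formula: the transform may be moved from the measure to the test function. *)
Lemma cintegral_fourier_measure (f : V -> R[i]) : schwartz f ->
  cintegral leb setT (fun xi => fourier_measure mu xi * f xi) =
  functional_of_measure mu (fourier f).
Proof.
move=> /schwartzE[/rschwartz_rapid r1 /rschwartz_rapid r2].
pose f1 := re_part f; pose f2 := im_part f.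
have [c1 c1l c1m] := fourier_measure_swap 0 r1.
have [c2 c2l c2m] := fourier_measure_swap 0 r2.
have [s1 s1l s1m] := fourier_measure_swap (- (pi / 2)) r1.
have [s2 s2l s2m] := fourier_measure_swap (- (pi / 2)) r2.
have ci c x h : rapid h -> rintegrable leb (fun xi => cos (- dotp xi x + c) * h xi).
  move=> rh; have := @cos_rapid_rintegrable R d h c (- x) rh.
  by under eq_fun do rewrite dotpC dotpNr.
have sE (t : R) : sin t = cos (t + - (pi / 2)) by exact: sin_cosB.
rewrite /functional_of_measure /cintegral; congr (_ +i* _)%C.
  transitivity (\int[leb]_xi ((\int[mu]_x cos (- dotp x xi + 0)) * f1 xi -
      (\int[mu]_x cos (- dotp x xi + - (pi / 2))) * f2 xi)).
    apply: eq_Rintegral => xi _; rewrite /fourier_measure /cintegral /=.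
    rewrite /f1 /re_part /f2 /im_part; case: (f xi) => a b /=.
    congr (_ * _ - _ * _); apply: eq_Rintegral => x _; rewrite ?addr0//.
  rewrite (RintegralB measurableT c1l s2l) c1 s2 -(RintegralB measurableT c1m s2m).
  apply: eq_Rintegral => x _.
  rewrite -(RintegralB measurableT (ci _ _ _ r1) (ci _ _ _ r2)); apply: eq_Rintegral => xi _ /=.
  by rewrite -sE addr0 /re_part /im_part; case: (f xi).
transitivity (\int[leb]_xi ((\int[mu]_x cos (- dotp x xi + 0)) * f2 xi +
    (\int[mu]_x cos (- dotp x xi + - (pi / 2))) * f1 xi)).
  apply: eq_Rintegral => xi _; rewrite /fourier_measure /cintegral /=.
  rewrite /f1 /re_part /f2 /im_part; case: (f xi) => a b /=.
  congr (_ * _ + _ * _); apply: eq_Rintegral => x _; rewrite ?addr0//.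
rewrite (RintegralD measurableT c2l s1l) c2 s1 -(RintegralD measurableT c2m s1m).
apply: eq_Rintegral => x _.
rewrite -(RintegralD measurableT (ci _ _ _ r2) (ci _ _ _ r1)); apply: eq_Rintegral => xi _ /=.
by rewrite -sE addr0 /re_part /im_part; case: (f xi).
Qed.

Lemma L_psi_conv_eq (gamma : R -> R[i]) (r : R) (L : functional R d) :
  gamma r != 0 -> is_L_psi_conv gamma r r mu L ->
  eq_on_schwartz L (functional_of_measure mu).
Proof.
move=> g0 [tL LE]; apply: tempered_eq_measure => // f sf _.
have := LE f sf; rewrite /fourier_functional => ->.
rewrite mulfV// mul1r -cintegral_fourier_measure//; congr (cintegral _ _ _).
(* With equal orders the symbol is |xi|^0, which is 1 at xi = 0 as well by the convention for
   [powR]. *)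
by apply/funext => xi; rewrite subrr powRr0 mul1r.
Qed.

End L_of_potential.

(** * Bumps and boxes *)

Section bump1.
Context {R : realType}.
Implicit Types (p : {poly R}) (t : R).

(** The classical flat function exp (- 1 / t), with a polynomial in 1 / t as parameter so that the
    family is closed under differentiation. *)
Definition bump p t : R := if 0 < t then p.[t^-1] * expR (- t^-1) else 0.

Lemma poly_le p : exists M n, 0 <= M /\ forall s : R, 0 <= s -> `|p.[s]| <= M * (1 + s) ^+ n.
Proof.
elim/poly_ind: p => [|p c [M [n [M0 H]]]].
  by exists 0, 0%N; split=> // s _; rewrite horner0 normr0 mul0r.
exists (M + `|c|), n.+1; split; first by rewrite addr_ge0.
move=> s s0; rewrite hornerMXaddC mulrDl (le_trans (ler_normD _ _))// lerD//.
  rewrite normrM (ger0_norm s0) exprSr mulrA ler_pM//; first exact: H.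
  by rewrite lerDr.
by rewrite ler_peMr// exprn_ege1// lerDl.
Qed.

Lemma bump_bounded p : exists2 C, 0 <= C & forall t, `|bump p t| <= C * t ^+ 2.
Proof.
have [M [n [M0 H]]] := poly_le p.
(* With s = 1 / t the claim bounds |p(s)| s^2 exp (- s): [n] powers come from [p], two from the
   desired factor t^2. *)
pose C := M * (n + 2)%:R ^+ (n + 2); have C0 : 0 <= C by rewrite mulr_ge0 ?exprn_ge0.
exists C => // t; rewrite /bump; case: ifPn => [t0|_]; last by rewrite normr0 mulr_ge0 ?sqr_ge0.
set s := t^-1; have s0 : 0 < s by rewrite invr_gt0.
have -> : t = s^-1 by rewrite invrK.
rewrite exprVn ler_pdivlMr ?exprn_gt0// normrM [`|expR _|]ger0_norm ?expR_ge0//.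
apply: (@le_trans _ _ (M * ((1 + s) ^+ (n + 2) * expR (- s)))); last first.
  by rewrite ler_wpM2l// poly_expRN_bounded// ltW.
rewrite [leLHS]mulrAC [leRHS]mulrA ler_wpM2r ?expR_ge0// exprD mulrA.
have h2 : s ^+ 2 <= (1 + s) ^+ 2.
  by rewrite lerXn2r ?nnegrE ?addr_ge0 ?(ltW s0)// lerDr.
rewrite -mulrA [leRHS]mulrA.
by apply: (ler_pM _ _ (H _ (ltW s0)) h2); rewrite // mulr_ge0 ?(ltW s0).
Qed.

(** The derivative of p(1/t) exp (- 1 / t) is t^-2 (p - p')(1/t) exp (- 1 / t). *)
Definition dbump p : {poly R} := 'X^2 * (p - p^`()).

Lemma derive_bump p t : is_derive t (1 : R) (bump p) (bump (dbump p) t).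
Proof.
have [t0|t0|->] := ltgtP t 0.
- rewrite [X in is_derive _ _ _ X](_ : _ = 0); last by rewrite /bump ltNge ltW.
  apply: (@near_eq_is_derive _ _ _ (cst 0)).
  by near=> s; rewrite /bump ltNge ltW//=; near: s; exact: lt_nbhsl.
- have hV : is_derive t (1 : R) (fun s : R => s^-1) (- (t ^- 2)).
    have := @is_deriveV R id t 1 1 (lt0r_neq0 t0) (is_derive_id t 1).
    by rewrite /GRing.scale/= mulr1.
  have h1 := @is_derive1_comp R (horner p) (fun s => s^-1) t _ _ (is_derive_poly p _) hV.
  have h2 := @is_derive1_comp R expR (fun s => - s^-1) t _ _ (is_derive_expR _) (is_deriveN hV).
  have h : is_derive t (1 : R) (fun s => p.[s^-1] * expR (- s^-1)) (bump (dbump p) t).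
    rewrite (_ : (fun s => _) = ((horner p) \o (fun s => s^-1)) * (expR \o (fun s => -
      s^-1)))//.
    apply: is_derive_eq.
    by rewrite /bump t0 /dbump /GRing.scale/= hornerM hornerXn hornerD hornerN exprVn; ring.
  apply: near_eq_is_derive h.
  by near=> s; rewrite /bump ifT//; near: s; exact: lt_nbhsr.
- rewrite [X in is_derive _ _ _ X](_ : _ = 0); last by rewrite /bump ltxx.
  have [C C0 hC] := bump_bounded p.
  (* At the origin the bound |bump p h| <= C h^2 makes the difference quotient O(|h|), whatever the
     side. *)
  have lim0 : h^-1 *: ((bump p \o shift 0) (h *: 1) - bump p 0) @[h --> 0^'] --> 0.
    apply/cvgr0Pnorm_le => e e0.
    near=> h.
    rewrite /= [h *: 1]mulr1 addr0 {2}/bump ltxx subr0 normrM.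
    have h0 : h != 0 by near: h; exact: nbhs_dnbhs_neq.
    rewrite normfV ler_pdivrMl ?normr_gt0//.
    apply: le_trans (hC h) _; rewrite -(real_normK (num_real h)) expr2 mulrCA.
    rewrite ler_wpM2l//; apply: (@le_trans _ _ ((C + 1) * `|h|)).
      by rewrite ler_wpM2r// lerDl.
    rewrite -ler_pdivlMl ?ltr_wpDl// mulrC.
    near: h; apply: cvg_within; apply/nbhs_ballP; exists (e / (C + 1)).
      by rewrite /= divr_gt0// ltr_wpDl.
    by move=> h; rewrite -ball_normE/= sub0r normrN => /ltW.
  by apply: DeriveDef; [apply/cvg_ex; exists 0|exact: cvg_lim].
Unshelve. all: by end_near.
Qed.

Lemma bump_ge0_le1 t : 0 <= bump 1 t <= 1.
Proof.
rewrite /bump hornerC mul1r; case: ifPn => [t0|_]; last by rewrite lexx ler01.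
by rewrite expR_ge0 -expR0 ler_expR oppr_le0 invr_ge0 ltW.
Qed.

Lemma bump_eq0 t : t <= 0 -> bump 1 t = 0.
Proof. by rewrite /bump ltNge => ->. Qed.

Lemma cvg_bump t : bump 1 (n.+1%:R * t) @[n --> \oo] --> ((0 < t)%R%:R : R).
Proof.
have [t0|t0] := ltP 0 t; last first.
  apply: cvg_near_cst; apply: nearW => n; rewrite bump_eq0//.
  by rewrite mulr_ge0_le0.
rewrite (_ : (fun n => _) = (fun n : nat => expR (- (t^-1 * n.+1%:R^-1)))); last first.
  by apply/funext => n; rewrite /bump mulr_gt0// hornerC mul1r invfM mulrC.
rewrite -[X in _ --> X]expR0; apply: continuous_cvg; first exact: continuous_expR.
rewrite -oppr0; apply: cvgN; rewrite -[X in _ --> X](mulr0 t^-1).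
by apply: cvgM; [exact: cvg_cst|exact: cvg_harmonic].
Qed.

End bump1.

Section boxes.
Context {R : realType} {d : nat}.
Local Notation V := 'rV[R]_d.
Implicit Types (a b : 'I_d -> R) (x : V).

Definition box a b : set V := [set x | forall i, a i < x ord0 i < b i].

Definition box_bump (k : R) a b x : R :=
  \prod_i (bump 1 (k * (x ord0 i - a i)) * bump 1 (k * (b i - x ord0 i))).

Lemma smooth_box_bump k a b : smooth (box_bump k a b).
Proof.
(* The coefficients are one-coordinate bumps with arbitrary affine argument and polynomial, and the
   only generator is 1, so [span A M] holds the finite sums of products of such bumps. *)
pose A (f : V -> R) := exists (r c s : R) i p, f = fun x => r * bump p (c * x ord0 i + s).
pose M (m : V -> R) := m = cst 1.
have AP f : A f -> exists2 df, has_grad f df & forall i, A (df i).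
  move=> [r [c [s [i [p ->]]]]].
  have h0 := has_gradD (has_gradM (has_grad_cst c) (has_grad_coord i)) (has_grad_cst s).
  have h1 := has_gradM (has_grad_cst r) (has_grad_comp h0 (fun t => derive_bump p t)).
  exists (fun j x => (r * c * (j == i)%:R) * bump (dbump p) (c * x ord0 i + s)).
    by move: h1; apply: has_grad_ext => j x /=; ring.
  by move=> j; exists (r * c * (j == i)%:R), c, s, i, (dbump p).
have MP m : M m -> exists2 dm, has_grad m dm & forall i, span A M (dm i).
  move=> ->; exists (fun _ => cst 0); first exact: has_grad_cst.
  (* The zero function is not a generator; it enters the span through a coefficient with r = 0. *)
  move=> i; rewrite (_ : cst 0 = (fun x : V => 0 * bump 1 (0 * x ord0 i + 0)) \* cst 1).
    by apply: span_mul; [exists 0, 0, 0, i, 1|exact: span_gen].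
  by apply/funext => x; rewrite /= !mul0r.
suff S : span A M (box_bump k a b) by have [] := smooth_coind (span_grad AP MP) S.
rewrite /box_bump /index_enum; elim: (Finite.enum _) => [|i s IH].
  rewrite (_ : (fun x => _) = cst 1); first exact: span_gen.
  by apply/funext => x; rewrite big_nil.
rewrite (_ : (fun x => _) = (fun x : V => 1 * bump 1 (k * x ord0 i + - (k * a i))) \*
    ((fun x : V => 1 * bump 1 ((- k) * x ord0 i + k * b i)) \*
     (fun x => \prod_(i <- s) (bump 1 (k * (x ord0 i - a i)) * bump 1 (k * (b i - x ord0
       i)))))).
  apply: span_mul; first by exists 1, k, (- (k * a i)), i, 1.
  by apply: span_mul => //; exists 1, (- k), (k * b i), i, 1.
apply/funext => x; rewrite big_cons /= !mul1r mulrA.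
by congr (bump _ _ * bump _ _ * _); ring.
Qed.

Lemma box_bump_ge0_le1 k a b x : 0 <= box_bump k a b x <= 1.
Proof.
rewrite /box_bump; apply/andP; split.
  by apply: prodr_ge0 => i _; rewrite mulr_ge0//;
    case/andP: (bump_ge0_le1 (k * (x ord0 i - a i)));
    case/andP: (bump_ge0_le1 (k * (b i - x ord0 i))).
apply: prodr_ile1 => i _.
have /andP[u0 u1] := bump_ge0_le1 (k * (x ord0 i - a i)).
have /andP[v0 v1] := bump_ge0_le1 (k * (b i - x ord0 i)).
by rewrite mulr_ge0//= mulr_ile1.
Qed.

Lemma box_bump_neq0 k a b x : 0 < k -> box_bump k a b x != 0 -> box a b x.
Proof.
move=> k0 /eqP h i; apply/andP; split; rewrite ltNge; apply/negP => h'; apply: h.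
  by rewrite /box_bump (bigD1 i)//= bump_eq0 ?mul0r// mulr_ge0_le0 ?(ltW k0)// subr_le0.
rewrite /box_bump (bigD1 i)//= [bump _ (k * (b i - _))]bump_eq0 ?mulr0 ?mul0r//.
by rewrite mulr_ge0_le0 ?(ltW k0)// subr_le0.
Qed.

Lemma cvg_box_bump a b x :
  box_bump n.+1%:R a b x @[n --> \oo] --> (\1_(box a b) x : R).
Proof.
have -> : \1_(box a b) x = \prod_i ((0 < x ord0 i - a i)%R%:R * (0 < b i - x ord0 i)%R%:R) :> R.
  rewrite indicE; have [/set_mem h|/negP h] := boolP (x \in box a b).
    by rewrite big1// => i _; have /andP[h1 h2] := h i; rewrite !subr_gt0 h1 h2 mulr1.
  have [i hi] : exists i, ~~ (a i < x ord0 i < b i).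
    apply: contrapT => /forallNP h'; apply: h; apply/mem_set => i.
    by have /negP := h' i; rewrite negbK.
  rewrite (bigD1 i)//= !subr_gt0 -natrM mulnb (negbTE hi) mul0r.
  by [].
apply: (@cvg_big R _ *%R 1 predT (@mul_continuous R)) => i _.
by apply: cvgM; exact: cvg_bump.
Qed.

Lemma test_field_box_bump k a b i : 0 < k ->
  test_field (fun x => box_bump k a b x *: (delta_mx ord0 i : V)).
Proof.
move=> k0; split.
  move=> j; rewrite (_ : (fun x => _) = fun x => 0 + (i == j)%:R * box_bump k a b x).
    move=> l x; have [s0 _] := @smooth_cst0 R d.
    rewrite iter_partial_lin//; last exact: smooth_box_bump.
    by have [] := has_grad_lin (i == j)%:R (smooth_iter_partial l s0) (smooth_iter_partial l
      (smooth_box_bump k a b)) x.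
  by apply/funext => x; rewrite !mxE eqxx/= eq_sym add0r mulrC.
split=> //.
pose C := \sum_i (`|a i| + `|b i|).
have C0 : 0 <= C by apply: sumr_ge0 => j _; rewrite addr_ge0.
have clC : closed [set x : V | `|x| <= C].
  rewrite (_ : [set x | _] = Num.norm @^-1` [set t | t <= C]) //.
  by apply: closed_comp => // x _; exact: norm_continuous.
have sub : closure [set x : V | box_bump k a b x *: (delta_mx ord0 i : V) != 0] `<=` [set x : V
  | `|x| <= C].
  rewrite [X in _ `<=` X](closure_id _).1//; apply: closureS => x /= h.
  have bx : box a b x.
    apply: (@box_bump_neq0 k) => //; apply: contra h => /eqP ->; by rewrite scale0r.
  apply: norm_rV_le => // j; have /andP[h1 h2] := bx j.
  rewrite /C (bigD1 j)//=; apply: (@le_trans _ _ (`|a j| + `|b j|)); last first.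
    by rewrite lerDl sumr_ge0// => *; rewrite addr_ge0.
  rewrite ler_norml; have := ler_norm (b j); have := ler_norm (- a j); rewrite normrN.
  by have := normr_ge0 (a j); have := normr_ge0 (b j) => *; apply/andP; split; lra.
apply: bounded_closed_compact; last exact: closed_closure.
exists C; split; first exact: num_real.
by move=> M CM x /sub /= xC; rewrite (le_trans xC)// ltW.
Qed.

Lemma open_box a b : open (box a b).
Proof.
suff H (s : seq 'I_d) : open [set x : V | forall i, i \in s -> a i < x ord0 i < b i].
  rewrite (_ : box a b = [set x : V | forall i, i \in index_enum 'I_d ->
    a i < x ord0 i < b i]) //.
  apply/seteqP; split=> x /= h i; [by move=> _|]; apply: h.
  by rewrite mem_index_enum.
elim: s => [|i s IH].
  by rewrite (_ : [set x | _] = setT); [exact: openT|apply/seteqP].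
rewrite (_ : [set x | _] = (fun x : V => x ord0 i) @^-1` `]a i, b i[ `&`
    [set x : V | forall i, i \in s -> a i < x ord0 i < b i]).
  apply: openI => //; have /continuousP := @coord_continuous R 1 d ord0 i.
  by apply; exact: interval_open.
apply/seteqP; split=> x /=; rewrite ?in_itv/=.
  by move=> h; split=> [|j js]; apply: h; rewrite inE ?eqxx// js orbT.
by move=> [h1 h2] j; rewrite inE => /orP[/eqP -> //|]; exact: h2.
Qed.

Lemma box_setI a b a' b' : box a b `&` box a' b' =
  box (fun i => Num.max (a i) (a' i)) (fun i => Num.min (b i) (b' i)).
Proof.
apply/seteqP; split=> x.
  move=> [h h'] i; rewrite gt_max lt_min.
  by have /andP[-> ->] := h i; have /andP[-> ->] := h' i.
move=> h; split=> i; have := h i; rewrite gt_max lt_min;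
  by move=> /andP[/andP[h1 h2] /andP[h3 h4]]; apply/andP.
Qed.

(** Cubes with rational centre and radius 1 / (n + 1): a countable base of the topology, indexed by
    a countable type. *)
Definition rat_box (p : 'rV[rat]_d * nat) : set V :=
  box (fun i => ratr (p.1 ord0 i) - p.2.+1%:R^-1) (fun i => ratr (p.1 ord0 i) + p.2.+1%:R^-1).

Lemma rat_box_nbhs (U : set V) x : open U -> U x ->
  exists p, rat_box p x /\ rat_box p `<=` U.
Proof.
move=> oU Ux.
have /nbhs_ballP[e /= e0 xeU] : nbhs x U by exact: open_nbhs_nbhs.
have [k ke] : exists k : nat, k.+1%:R^-1 < e / 2.
  have e20 : 0 < e / 2 by rewrite divr_gt0.
  exists (Num.truncn (e / 2)^-1).
  by rewrite invf_plt ?posrE ?ltr0n// truncnS_gt.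
have /choice[w hw] : forall i : 'I_d, exists q : rat,
    `|x ord0 i - ratr q| < k.+1%:R^-1.
  move=> i; have : x ord0 i - k.+1%:R^-1 < x ord0 i + k.+1%:R^-1.
    by rewrite ltrBlDr -addrA ltrDl addr_gt0 ?invr_gt0.
  move=> /rat_in_itvoo[q]; rewrite in_itv/= => /andP[x1 x2].
  by exists q; rewrite ltr_distlC x1 x2.
exists (\row_i w i, k); split=> [i|y yB].
  by rewrite /= mxE -ltr_distl; exact: hw.
apply: xeU; split=> // i j; rewrite (ord1 i).
have := yB j; rewrite /= mxE -ltr_distl => yw.
have := hw j; rewrite /ball/= => xw.
rewrite -(subrK (ratr (w j)) (x ord0 j)) -addrA (le_lt_trans (ler_normD _ _))//.
rewrite (splitr e) ltrD//; first exact: lt_trans ke.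
by rewrite distrC; exact: lt_trans ke.
Qed.

Lemma measurable_box_generated : @measurable _ V = <<s [set B | exists a b, B = box a b] >>.
Proof.
apply/seteqP; split; last first.
  apply: smallest_sub; first exact: sigma_algebra_measurable.
  by move=> _ [a [b ->]]; apply: open_measurable_rV; exact: open_box.
apply: smallest_sub; first exact: smallest_sigma_algebra.
move=> U oU.
have -> : U = \bigcup_(p in [set p | rat_box p `<=` U]) rat_box p.
  apply/seteqP; split=> [x Ux|x [p /= BU Bx]]; last exact: BU.
  by have [p [px pU]] := rat_box_nbhs oU Ux; exists p.
rewrite bigcup_mkcond.
apply: (@countable_bigcupT_measurable _ (g_sigma_algebraType [set B : set V | exists a b,
  B = box a b])).
  exact: countableP.
move=> p; case: ifPn => // _.
by apply: sub_sigma_algebra; do 2 eexists.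
Qed.

Variable mu : {measure set V -> \bar R}.

(** A Lindelof argument: the vanishing set is covered by the null boxes of the countable base. *)
Lemma vanishing_set_null : mu (vanishing_set mu) = 0%E.
Proof.
apply/negligibleP; first by apply: open_measurable_rV; exact: open_interior.
pose F (n : nat) : set V := if @unpickle ('rV[rat]_d * nat)%type n is Some p
  then (if mu (rat_box p) == 0%E then rat_box p else set0) else set0.
apply: (@negligibleS _ _ _ mu (\bigcup_n F n)).
  move=> x /interior_subset [U [oU Ux] U0].
  have [p [px pU]] := rat_box_nbhs oU Ux.
  exists (pickle p) => //; rewrite /F pickleK ifT//.
  rewrite eq_le measure_ge0 andbT -U0 le_measure// inE; apply: open_measurable_rV => //.
  exact: open_box.
apply: negligible_bigcup => n; rewrite /F; case: (unpickle n) => [p|];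
  last exact: negligible_set0.
case: ifPn => [/eqP p0|_]; last exact: negligible_set0.
by apply/negligibleP => //; apply: open_measurable_rV; exact: open_box.
Qed.

End boxes.

(** * Functions determined by their integrals over boxes *)

Section ae_eq0_boxes.
Context {R : realType} {d : nat}.
Local Notation V := 'rV[R]_d.
Variable mu : {finite_measure set V -> \bar R}.

(** The positive and negative parts of [K] are densities of two finite measures agreeing on boxes.
    Boxes form a generating class stable under intersection, so the measures coincide and all
    integrals of [K] vanish. *)
Lemma ae_eq0_box (K : V -> R) : rintegrable mu K ->
  (forall a b, \int[mu]_(x in box a b) (K x)%:E = 0)%E ->
  {ae mu, forall x, K x = 0}.
Proof.
move=> iK K0.
have ip : mu.-integrable setT (EFin \o K)^\+%E by exact: integrable_funepos.
have im : mu.-integrable setT (EFin \o K)^\-%E by exact: integrable_funeneg.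
have p0 A : (0 <= induced_charge ip A)%E by apply: integral_ge0 => x _; exact: funepos_ge0.
have m0 A : (0 <= induced_charge im A)%E by apply: integral_ge0 => x _; exact: funeneg_ge0.
pose m1 : {measure set V -> \bar R} := measure_of_charge (induced_charge ip) p0.
pose m2 : {measure set V -> \bar R} := measure_of_charge (induced_charge im) m0.
have fin1 A : measurable A -> (\int[mu]_(x in A) (EFin \o K)^\+ x)%E \is a fin_num.
  by move=> mA; apply: integrable_fin_num => //; exact: (integrableS measurableT mA (@subsetT _
    _) ip).
have fin2 A : measurable A -> (\int[mu]_(x in A) (EFin \o K)^\- x)%E \is a fin_num.
  by move=> mA; apply: integrable_fin_num => //; exact: (integrableS measurableT mA (@subsetT _
    _) im).
have mbox (a b : 'I_d -> R) : measurable (box a b).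
  by apply: open_measurable_rV; exact: open_box.
have m12 A : measurable A -> m1 A = m2 A.
  apply: (measure_unique [set B | exists a b, B = box a b]
      (fun n => box (fun _ => - n%:R) (fun _ => n%:R))).
  - exact: measurable_box_generated.
  - by move=> _ _ [a [b ->]] [a' [b' ->]]; rewrite box_setI; do 2 eexists.
  - by move=> n; do 2 eexists.
  - apply/seteqP; split=> // x _; exists (Num.truncn `|x|).+1 => // i /=.
    by rewrite -ltr_norml (le_lt_trans (coord_le_norm x i))// truncnS_gt.
  - move=> _ [a [b ->]]; have := K0 a b; rewrite integralE => /eqP.
    by rewrite sube_eq ?fin1 ?fin2 ?add0e// => /eqP.
  - by move=> n; have := fin1 _ (mbox (fun _ => - n%:R) (fun _ => n%:R));
    rewrite ge0_fin_numE ?p0.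
have := @integral_ae_eq _ _ _ mu setT measurableT (cst 0%E) (EFin \o K) iK.
move=> /(_ _ _); case=> //.
  move=> E _ mE; rewrite integral0 integralE.
  have : (\int[mu]_(x in E) (EFin \o K)^\+ x = \int[mu]_(x in E) (EFin \o K)^\- x)%E := m12 E
    mE.
  by move=> ->; rewrite subee// fin2.
move=> N [mN N0 sub]; exists N; split=> // x xK; apply: sub => /= h; apply: xK.
by case: (h Logic.I) => <-.
Qed.

Lemma box_bump_ae_eq0 (K : V -> R) : rintegrable mu K ->
  (forall (n : nat) a b, \int[mu]_x (box_bump n.+1%:R a b x * K x) = 0) ->
  {ae mu, forall x, K x = 0}.
Proof.
move=> iK H; apply: ae_eq0_box => // a b.
have mK := rintegrable_measurable iK.
have mb n : measurable_fun setT (box_bump n.+1%:R a b).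
  apply: continuous_measurable_rV_R; exact/smooth_continuous/smooth_box_bump.
have bK n x : `|box_bump n.+1%:R a b x * K x| <= `|K x|.
  have /andP[h0 h1] := box_bump_ge0_le1 n.+1%:R a b x.
  by rewrite normrM ler_piMl// ger0_norm.
have ib n : rintegrable mu (fun x => box_bump n.+1%:R a b x * K x).
  by apply: (rintegrable_le _ (bK n)); [exact: measurable_funM|exact: rintegrable_abs].
have [] := @dominated_convergence _ _ _ mu setT measurableT
  (fun n x => (box_bump n.+1%:R a b x * K x)%:E)
  (fun x => (\1_(box a b) x * K x)%:E) (fun x => `|K x|%:E).
- by move=> n; apply/measurable_EFinP/measurable_funM.
- apply/measurable_EFinP/measurable_funM => //; apply: measurable_indic.
  by apply: open_measurable_rV; exact: open_box.
- apply: aeW => x _; apply: cvg_EFin; first exact: nearW.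
  by apply: cvgM; [exact: cvg_box_bump|exact: cvg_cst].
- exact: rintegrable_abs.
- by apply: aeW => x n _; rewrite /= lee_fin; exact: bK.
move=> _ _ /cvg_lim h; rewrite integral_mkcond.
transitivity (\int[mu]_x (\1_(box a b) x * K x)%:E)%E.
  by apply: eq_integral => x _; rewrite /patch indicE; case: ifP => _; rewrite ?mul1r ?mul0r.
rewrite -h//; apply/cvg_lim => //; apply: cvg_near_cst; apply: nearW => n.
apply: etrans (esym (fineK (integrable_fin_num measurableT (ib n)))) _.
by congr EFin; exact: H.
Qed.

End ae_eq0_boxes.

(** * Zero-flux stationary states *)

Section interaction.
Context {R : realType} {d : nat}.
Local Notation V := 'rV[R]_d.

(** The factor x_i absorbs the special value at the origin, leaving one formula whose measurability
    is plain. *)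
Lemma Kgrad_coord s (x : V) i :
  Kgrad s x ord0 i = (1 + s) * enorm x `^ (s - 1) * x ord0 i.
Proof.
rewrite /Kgrad; case: eqVneq => [->|_]; first by rewrite mxE mulr0.
by rewrite mxE.
Qed.

(** The integral may diverge at some points, where [Rintegral] takes a default value. Tonelli makes
    the integrals of the positive and negative parts measurable in x, and [fine] of their difference
    is the convolution everywhere. *)
Lemma measurable_K_conv s (mu : {finite_measure set V -> \bar R}) i :
  measurable_fun setT (fun x => K_conv s mu x ord0 i).
Proof.
pose f (z : V * V) : \bar R := (Kgrad s (z.1 - z.2) ord0 i)%:E.
have mc j : measurable_fun setT (fun z : V * V => (z.1 - z.2) ord0 j).
  rewrite (_ : (fun _ => _) = fun z : V * V => z.1 ord0 j - z.2 ord0 j); last first.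
    by apply/funext => z; rewrite !mxE.
  by apply: measurable_funB; exact: (measurableT_comp (measurable_coord j)).
have mf : measurable_fun setT f.
  apply/measurable_EFinP.
  rewrite (_ : (fun _ => _) = fun z : V * V => (1 + s) * enorm (z.1 - z.2) `^ (s - 1) * (z.1 -
    z.2) ord0 i); last first.
    by apply/funext => z; rewrite Kgrad_coord.
  apply: measurable_funM => //; apply: measurable_funM => //.
  apply: (measurableT_comp (measurable_powR _)).
  rewrite /enorm; apply: (measurableT_comp (f := @Num.sqrt R)).
    by apply: continuous_measurable_fun; exact: sqrt_continuous.
  by apply: measurable_sum => j; exact: measurable_funM.
rewrite (_ : (fun _ => _) = fine \o ((fun x => \int[mu]_y f^\+ (x,
  y)) \- (fun x => \int[mu]_y f^\- (x, y)))%E); last first.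
  apply/funext => x; rewrite mxE /Rintegral /= integralE; congr fine.
  by congr (_ - _)%E; apply: eq_integral => y _; rewrite !(funeposE, funenegE).
apply: (measurableT_comp (fine_measurable measurableT)) => //.
apply: emeasurable_funB.
- apply: (measurable_fun_fubini_tonelli_F (m2 := mu) f^\+%E) => //; exact: measurable_funepos.
- apply: (measurable_fun_fubini_tonelli_F (m2 := mu) f^\-%E) => //; exact: measurable_funeneg.
Qed.

Variables (a r : R) (omega mu : {finite_measure set V -> \bar R}).
Local Notation F := (interaction_field a r omega mu).

Lemma measurable_interaction i : measurable_fun setT (fun x => F x ord0 i).
Proof.
rewrite (_ : (fun _ => _) = fun x => K_conv a omega x ord0 i - K_conv r mu x ord0 i).
  by apply: measurable_funB; exact: measurable_K_conv.
by apply/funext => x; rewrite !mxE.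
Qed.

Lemma dotp0r (x : V) : dotp x 0 = 0.
Proof. by rewrite /dotp big1// => i _; rewrite mxE mulr0. Qed.

Variable G : V -> V.
Hypotheses (GF : {ae mu, forall x, G x = F x})
  (iG : forall i, rintegrable mu (fun x => G x ord0 i)).

(** Almost everywhere equality with [G] transfers the finiteness of the integral but not
    measurability, as [mu] need not be complete; hence the separate measurability lemma. *)
Lemma rintegrable_interaction i : rintegrable mu (fun x => F x ord0 i).
Proof.
have mF := measurable_interaction i.
apply/integrableP; split; first exact/measurable_EFinP.
have /integrableP[mG] := iG i; apply: le_lt_trans.
rewrite le_eqVlt; apply/orP; left; apply/eqP; apply: ae_eq_integral => //.
- by apply: measurableT_comp => //; exact/measurable_EFinP.
- exact: measurableT_comp.
- by move: GF; apply: filterS => x GFx _ /=; rewrite GFx.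
Qed.

Lemma ae_forall_ord (P : 'I_d -> V -> Prop) :
  (forall i, {ae mu, forall x, P i x}) -> {ae mu, forall x, forall i, P i x}.
Proof.
move=> H; suff Hs (s : seq 'I_d) : {ae mu, forall x, forall i, i \in s -> P i x}.
  by have := Hs (index_enum 'I_d); apply: filterS => x h i; apply: h; rewrite mem_index_enum.
elim: s => [|i s IH]; first exact: aeW.
have := H i; move: IH; apply: filterS2 => x h1 h2 j.
by rewrite inE => /orP[/eqP ->//|]; exact: h1.
Qed.

(** Box bumps times a basis vector isolate one coordinate of the field. They are bounded by 1, so
    the integrability premise in the definition of zero flux is met by the integrability of that
    coordinate. *)
Lemma zero_flux_ae : zero_flux_stationary a r omega mu <-> {ae mu, forall x, F x = 0}.
Proof.
split=> [H|H xi _ flux iflux]; last first.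
  rewrite /Rintegral (@ae_eq_integral _ _ _ mu setT (cst 0%E)) ?integral0//.
    exact: measurable_int iflux.
  by move: H; apply: filterS => x Fx _ /=; rewrite /flux Fx dotp0r.
suff H' i : {ae mu, forall x, F x ord0 i = 0}.
  have := ae_forall_ord H'; apply: filterS => x h.
  by apply/rowP => i; rewrite h mxE.
have iF := rintegrable_interaction i.
apply: box_bump_ae_eq0 => // n p q.
have k0 : 0 < n.+1%:R :> R by [].
have := H _ (test_field_box_bump p q i k0).
have E x : dotp (box_bump n.+1%:R p q x *: (delta_mx ord0 i : V)) (F x) =
    box_bump n.+1%:R p q x * F x ord0 i.
  rewrite dotpZl; congr (_ * _); rewrite /dotp (bigD1 i)//= mxE !eqxx mul1r big1 ?addr0//.
  by move=> j ji; rewrite mxE (negbTE ji) andbF mul0r.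
rewrite /=; under eq_Rintegral do rewrite E.
apply; rewrite (_ : _ \o _ = EFin \o (fun x => box_bump n.+1%:R p q x * F x ord0 i));
  last first.
  by apply/funext => x /=; rewrite E.
apply: (@rintegrable_le _ _ _ mu _ (fun x => `|F x ord0 i|)); last exact: rintegrable_abs.
  apply: measurable_funM; last exact: measurable_interaction.
  by apply: continuous_measurable_rV_R; exact/smooth_continuous/smooth_box_bump.
move=> x; have /andP[h0 h1] := box_bump_ge0_le1 n.+1%:R p q x.
by rewrite normrM ler_piMl// ger0_norm.
Qed.

Lemma zero_flux_grad : zero_flux_stationary a r omega mu <->
  {ae mu, forall x, (~` vanishing_set mu) x -> G x = 0}.
Proof.
rewrite zero_flux_ae; split.
  by move: GF; apply: filterS2 => x -> ->.
have nO : {ae mu, forall x, ~ vanishing_set mu x}.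
  exists (vanishing_set mu); split.
  - by apply: open_measurable_rV; exact: open_interior.
  - exact: vanishing_set_null.
  - by move=> x /= /contrapT.
by move: nO GF; apply: filterS3 => x h1 h2 h3; rewrite -h2 h3.
Qed.

End interaction.

(** * Test functions and null open sets *)

Section test_function.
Context {R : realType} {d : nat}.
Local Notation V := 'rV[R]_d.
Implicit Types h : V -> R.

Lemma iter_partial_open0 (U : set V) h l : open U -> (forall x, U x -> h x = 0) ->
  forall x, U x -> iter_partial l h x = 0.
Proof.
move=> oU h0; elim: l => //= i l IH x Ux.
rewrite /partial (@near_eq_derive _ _ _ _ (cst 0)) ?derive_cst//.
have : nbhs x U by exact: open_nbhs_nbhs.
by apply: filterS => y Uy; rewrite IH.
Qed.

(** On [K] every derivative and weight is bounded by compactness; off [K], which is closed, all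
    derivatives vanish because the function is zero on an open set. *)
Lemma rschwartz_compact (K : set V) h : smooth h -> compact K ->
  (forall x, ~ K x -> h x = 0) -> rschwartz h.
Proof.
move=> sh cK h0; split=> // l k.
have sl := smooth_iter_partial l sh.
have bnd (A : R) : A < `|A| + 1 by rewrite (le_lt_trans (ler_norm A))// ltrDl.
have [B [_ HB]] := compact_bounded cK.
have [M [_ HM]] := compact_bounded (continuous_compact
  (continuous_subspaceT (smooth_continuous sl)) cK).
exists ((1 + (`|B| + 1)) ^+ k * (`|M| + 1)) => x; have [Kx|Kx] := pselect (K x).
  apply: ler_pM; rewrite ?exprn_ge0 ?addr_ge0//.
    by rewrite lerXn2r ?nnegrE ?addr_ge0// lerD2l; exact: (HB _ (bnd B)).
  by apply: (HM _ (bnd M)); exists x.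
have -> : iter_partial l h x = 0.
  apply: (iter_partial_open0 l (U := ~` K)) => //.
  apply: closed_openC; apply: compact_closed => //; exact: norm_hausdorff.
by rewrite normr0 mulr0 mulr_ge0 ?exprn_ge0 ?addr_ge0.
Qed.

Lemma test_function_schwartz (U : set V) (f : V -> R[i]) : test_function U f -> schwartz f.
Proof.
move=> [s1 s2 [cK _]]; apply/schwartzE.
have f0 x : ~ closure [set x | f x != 0] x -> f x = 0.
  move=> h; apply/eqP/negPn/negP => fx; apply: h.
  exact: subset_closure.
by split; apply: rschwartz_compact cK _ => // x /f0; rewrite /re_part /im_part => ->.
Qed.

Lemma functional_of_measure_test (mu : {measure set V -> \bar R}) (U : set V) f :
  measurable U -> mu U = 0%E -> test_function U f -> functional_of_measure mu f = 0.
Proof.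
move=> mU U0 tf; have /schwartzE[r1 r2] := test_function_schwartz tf.
have [_ _ [_ sub]] := tf.
have f0 x : ~ U x -> f x = 0.
  move=> h; apply/eqP/negPn/negP => fx; apply: h; apply: sub.
  exact: subset_closure.
have I0 (g : V -> R) : measurable_fun setT g -> (forall x,
  ~ U x -> g x = 0) -> \int[mu]_x g x = 0.
  move=> mg g0; rewrite /Rintegral (@ae_eq_integral _ _ _ mu setT (cst 0%E)) ?integral0//.
    exact/measurable_EFinP.
  exists U; split=> // x /= h; apply: contrapT => nU; apply: h => _.
  by rewrite g0.
rewrite /functional_of_measure /cintegral !I0//.
- by case: (rschwartz_rapid r2).
- by move=> x /f0 ->.
- by case: (rschwartz_rapid r1).
- by move=> x /f0 ->.
Qed.

End test_function.

Theorem theorem6p2 (R : realType) (d : nat) (d_ge1 : (1 <= d)%N)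
    (gamma : R -> R[i]) (gammaP : is_psi_fourier_constant d gamma)
    (a r : R) (r_ge0 : 0 <= r) (r_le_a : r <= a) (a_lt1 : a < 1)
    (omega : {finite_measure set 'rV[R]_d -> \bar R})
    (phi : probability 'rV[R]_d R)
    (phi_tempered : admissible r phi)
    (phi_frakP : frakP r (psi_conv_functional r phi))
    (omega_admissible : admissible a omega)
    (Q_ar L_psi_phi : functional R d)
    (Q_arP : is_L_psi_conv gamma r a omega Q_ar)
    (L_psi_phiP : is_L_psi_conv gamma r r phi L_psi_phi)
    (gradF : 'rV[R]_d -> 'rV[R]_d)
    (gradFP : borel_gradient a r omega phi gradF)
    (gradF_int : forall i : 'I_d,
       phi.-integrable setT (fun x => (gradF x ord0 i)%:E)) :
  let LF := sub_functional Q_ar L_psi_phi in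
  let Omega := vanishing_set phi in
  let S := ~` Omega in
  let gradF_eq0 := {ae phi, forall x, S x -> gradF x = 0} in
  let phi_eq :=
    eq_on_schwartz (functional_of_measure phi) (sub_functional Q_ar LF) in
  (zero_flux_stationary a r omega phi <-> gradF_eq0 /\ phi_eq) /\
  (gradF_eq0 /\ phi_eq <->
   [/\ phi_eq,
       eq_on_test Omega LF Q_ar,
       gradF_eq0 &
       exists nu : {finite_measure set 'rV[R]_d -> \bar R},
         [/\ eq_on_schwartz (functional_of_measure nu) (sub_functional Q_ar LF),
             supported_in nu S &
             nu setT = 1%E]]).
Proof.
move=> LF Omega S gradF_eq0 phi_eq.
have [_ _ gradFE] := gradFP.
have r01 : 0 <= r < 1 by rewrite r_ge0 (le_lt_trans r_le_a).
have Lphi : eq_on_schwartz L_psi_phi (functional_of_measure phi).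
  by apply: L_psi_conv_eq L_psi_phiP; exact: (gammaP r r01).1.
have phi_eqP : phi_eq.
  by move=> f sf; rewrite /sub_functional /LF /sub_functional opprB addrCA subrr addr0 Lphi.
split.
  split=> [/(zero_flux_grad gradFE gradF_int)//|[h _]].
  by apply/(zero_flux_grad gradFE gradF_int).
split=> [[h _]|[]//]; split=> //.
  move=> f tf; rewrite /LF /sub_functional Lphi; last exact: test_function_schwartz tf.
  rewrite (functional_of_measure_test _ _ tf) ?subr0//.
    by apply: open_measurable_rV; exact: open_interior.
  exact: vanishing_set_null.
(* The measure represented by Q - L_r F is [phi] itself, which gives positivity and unit mass; its
   support condition is the nullity of [Omega]. *)
exists phi; split=> //.
  by rewrite /supported_in setCK; exact: vanishing_set_null.
exact: probability_setT.
Qed.
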